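(* Let $K$ be a field, and let $\mathcal{D}=(V(\mathcal{D}),E(\mathcal{D}),w)$ be a vertex-weighted oriented graph with $w(i)=1$ for every source $i$, whose underlying graph $G$ is a forest with vertex set $[n]$ and with matching number $\nu(G)\ge 2$. Let $S=K[x_1,\dots,x_n]$, and suppose that $I(\mathcal{D})\neq I(G)$. Then the following conditions are equivalent. (a) $I(\mathcal{D})^{[\nu(G)]}$ is linearly related. (b) $I(\mathcal{D})^{[\nu(G)]}$ is polymatroidal. (c) $I(\mathcal{D})^{[\nu(G)]}$ has a linear resolution. (d) At least one of the following conditions (d-1), (d-2), (d-3) holds: (d-1) $G$ has an isolated edge $\{a,b\}$ such that $I(\mathcal{D}\setminus\{a,b\})^{[\nu(G)-1]}$ is polymatroidal, and $$I(\mathcal{D})^{[\nu(G)]}=\mathbf{x}_{\{a,b\}}^{(\mathcal{D})}\,I(\mathcal{D}\setminus\{a,b\})^{[\nu(G)-1]}.$$ (d-2) $G$ has a distant configuration $(a\mid b,c)$ such that $\{a,b\}$ is a strong edge of $G$, $I(\mathcal{D}\setminus\{a,b\})^{[\nu(G)-1]}$ is polymatroidal, and $$I(\mathcal{D})^{[\nu(G)]}=\mathbf{x}_{\{a,b\}}^{(\mathcal{D})}\,I(\mathcal{D}\setminus\{a,b\})^{[\nu(G)-1]}.$$ (d-3) $G$ has a distant configuration $(a_1,\dots,a_t\mid b,c)$ such that $w(a_1)=\dots=w(a_t)=1$, the ideal $I(\mathcal{D}\setminus\{b\})^{[\nu(G)-1]}$ is polymatroidal, and moreover the following two statements hold: (d-3-i)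 If $I(\mathcal{D}\setminus\{b,c\})^{[\nu(G)-1]}=0$, then there is $\delta\in\{1,w(b)\}$ such that $\mathbf{x}_{\{a_i,b\}}^{(\mathcal{D})}=x_{a_i}x_b^{\delta}$ for all $i=1,\dots,t$, and $$I(\mathcal{D})^{[\nu(G)]}=x_b^{\delta}\big[(x_{a_1},\dots,x_{a_t})\,I(\mathcal{D}\setminus\{b\})^{[\nu(G)-1]}\big].$$ (d-3-ii) If $I(\mathcal{D}\setminus\{b,c\})^{[\nu(G)-1]}\neq 0$, then $I(\mathcal{D}\setminus\{b,c\})^{[\nu(G)-1]}$ is polymatroidal, $\mathbf{x}_{\{a_i,b\}}^{(\mathcal{D})}=x_{a_i}x_b^{w(b)}$ for all $i=1,\dots,t$, $w(c)=1$, and $$I(\mathcal{D})^{[\nu(G)]}=x_b^{w(b)}\big[(x_{a_1},\dots,x_{a_t})\,I(\mathcal{D}\setminus\{b\})^{[\nu(G)-1]}+x_c\,I(\mathcal{D}\setminus\{b,c\})^{[\nu(G)-1]}\big].$$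
   Context: **Graphs and matchings.** Graphs are finite and simple, with vertex set $V(G)=[n]=\{1,\dots,n\}$ and edge set $E(G)$. A forest is a graph with no cycles. A $k$-matching of $G$ is a set of $k$ pairwise disjoint edges; the matching number $\nu(G)$ is the maximum size of a matching. The edge ideal of $G$ is $I(G)=(x_ix_j:\{i,j\}\in E(G))\subset S=K[x_1,\dots,x_n]$. **Weighted oriented graphs.** A (vertex-)weighted oriented graph $\mathcal{D}=(V(\mathcal{D}),E(\mathcal{D}),w)$ consists of an underlying graph $G$ with $V(\mathcal{D})=V(G)$, an orientation of each edge of $G$, where $(i,j)\in E(\mathcal{D})$ denotes an edge directed from $i$ to $j$, and a weight function $w:V(G)\to\mathbb{Z}_{\ge 1}$. Its edge ideal is $I(\mathcal{D})=(x_ix_j^{w(j)}:(i,j)\in E(\mathcal{D}))\subset S$. A vertex $i$ is a source if $(j,i)\notin E(\mathcal{D})$ for all $j$; sources are assumed to have weight $1$ in $\mathcal{D}$ (this does not affect $I(\mathcal{D})$). For $W\subset V(\mathcal{D})$, $\mathcal{D}\setminus W$ is the induced weighted oriented subgraph on $V(\mathcal{D})\setminus W$ (with the restricted orientation and weights), and its edge ideal is regarded as an ideal of $S$. For $\{a,b\}\in E(G)$, set $\mathbf{x}_{\{a,b\}}^{(\mathcal{D})}=x_ax_b^{w(b)}$ if $(a,b)\in E(\mathcal{D})$, and $\mathbf{x}_{\{a,b\}}^{(\mathcal{D})}=x_bx_a^{w(a)}$ if $(b,a)\in E(\mathcal{D})$. **Matching powers.** For a monomial ideal $I\subset S$ and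 $k\ge 1$, the $k$th matching power $I^{[k]}$ is the monomial ideal generated by all products $u_1\cdots u_k$ of monomials $u_1,\dots,u_k\in I$ with pairwise disjoint supports (the support of a monomial is the set of $i$ such that $x_i$ divides it); it is $0$ if there are no such products. Equivalently, $I(\mathcal{D})^{[k]}$ is generated by the products $\mathbf{x}_{e_1}^{(\mathcal{D})}\cdots\mathbf{x}_{e_k}^{(\mathcal{D})}$ with $\{e_1,\dots,e_k\}$ a $k$-matching of $G$. **Algebraic notions.** $G(I)$ denotes the minimal monomial generating set of a monomial ideal $I$, and $\deg_{x_i}(u)$ is the largest $j$ such that $x_i^j$ divides the monomial $u$. A monomial ideal $I$ is polymatroidal if it is generated in a single degree and for all $u,v\in G(I)$ and all $i$ with $\deg_{x_i}(u)>\deg_{x_i}(v)$ there is $j$ with $\deg_{x_j}(u)<\deg_{x_j}(v)$ and $x_j(u/x_i)\in G(I)$. A graded ideal $I$ generated in a single degree $d$ is linearly related if its first syzygy module is generated by linear relations, i.e. the graded Betti numbers satisfy $\beta_{1,j}(I)=0$ for all $j\neq d+1$; it has a linear resolution if $\beta_{i,j}(I)=0$ for all $i$ and all $j\ne d+i$. **Special edges and configurations.** A leaf of $G$ is a vertex incident to exactly one edge. An edge $\{a,b\}$ is isolated if both $a$ and $b$ are leaves. An edge of $G$ is strong if it belongs to every matching of $G$ of size $\nu(G)$. A leaf $a$ with unique neighbor $b$ is a distant leaf if at most one of the neighbors of $b$ is not a leaf. A distant configuration $(a_1,\dots,a_t\mid b,c)$ of a forest $G$, with $t\ge 1$, consists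 of distinct vertices $a_1,\dots,a_t,b,c$ such that $a_1,\dots,a_t$ are distant leaves and the neighbors of $b$ in $G$ are exactly $a_1,\dots,a_t,c$ (the vertex $c$ may or may not be a leaf). *)

(* Defs.v *)
From HB Require Import structures.
From mathcomp Require Import all_boot all_order all_algebra.
From mathcomp Require Import mpoly.

Set Implicit Arguments.
Unset Strict Implicit.
Unset Printing Implicit Defensive.

Import GRing.Theory.
Local Open Scope ring_scope.

(* Graphs on a subset of {1, ..., n}, given by their adjacency relation       *)
(* e : rel 'I_n, meant to be symmetric and irreflexive.                       *)

Section Graphs.
Variables (n : nat) (e : rel 'I_n).
Implicit Types (a b c : 'I_n) (M : {set {set 'I_n}}).

Definition edges : {set {set 'I_n}} :=
  [set E : {set 'I_n} | [exists a, exists b, e a b && (E == [set a; b])]].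

Definition is_matching M : bool := (M \subset edges) && trivIset M.

Definition matching_number : nat := (\max_(M | is_matching M) #|M|)%N.

(* [:: x; y] is a ucycle as soon as {x, y} is an edge, hence the size bound. *)
Definition forest : Prop := forall s : seq 'I_n, (2 < size s)%N -> ~ ucycle e s.

Definition neighbors a : {set 'I_n} := [set b | e a b].

Definition leaf a : bool := (#|neighbors a| == 1)%N.

Definition isolated_edge a b : bool := [&& e a b, leaf a & leaf b].

Definition strong_edge a b : bool :=
  e a b && [forall M : {set {set 'I_n}},
              is_matching M && (#|M| == matching_number)%N ==> ([set a; b] \in M)].

Definition distant_leaf a : bool :=
  leaf a &&
  [forall b, e a b ==> (#|[set c in neighbors b | ~~ leaf c]| <= 1)%N].

(* (a_1, ..., a_t | b, c) with s = [:: a_1; ...; a_t] *)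
Definition distant_configuration (s : seq 'I_n) b c : Prop :=
  [/\ (0 < size s)%N, uniq [:: b, c & s], all distant_leaf s
    & forall x, e b x = (x \in c :: s)].

End Graphs.

(* Orientation of a simple graph: arc_asym also excludes loops.  Weights of   *)
(* vertices outside [verts] are irrelevant.                                   *)
Record wograph (n : nat) := WOGraph {
  verts : {set 'I_n};
  arc : rel 'I_n;
  wt : 'I_n -> nat;
  arc_verts : forall i j, arc i j -> (i \in verts) && (j \in verts);
  arc_asym : forall i j, arc i j -> ~~ arc j i;
  wt_gt0 : forall i, (0 < wt i)%N
}.

Definition adj n (D : wograph n) : rel 'I_n :=
  fun i j => arc D i j || arc D j i.

Definition source n (D : wograph n) (i : 'I_n) : Prop :=
  i \in verts D /\ forall j, ~~ arc D j i.

Section Delete.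
Variables (n : nat) (D : wograph n) (W : {set 'I_n}).

Definition del_arc : rel 'I_n :=
  fun i j => [&& i \notin W, j \notin W & arc D i j].

Lemma del_arc_verts i j :
  del_arc i j -> (i \in verts D :\: W) && (j \in verts D :\: W).
Proof.
by case/and3P=> iW jW /arc_verts/andP[iV jV]; rewrite !inE iW jW iV jV.
Qed.

Lemma del_arc_asym i j : del_arc i j -> ~~ del_arc j i.
Proof. by case/and3P=> iW jW /arc_asym; rewrite /del_arc iW jW. Qed.

Definition delete : wograph n :=
  WOGraph del_arc_verts del_arc_asym (wt_gt0 D).

End Delete.

(* Ideals of S = K[x_1, ..., x_n] are handled as predicates on S; every       *)
(* predicate built below by an ideal operation is an ideal.                   *)

Section Ideals.
Variables (K : fieldType) (n : nat).
Local Notation S := {mpoly K[n]}.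
Implicit Types (I J : S -> Prop) (f g : S) (u v : 'X_{1..n}).

Definition ideal_eq I J : Prop := forall f, I f <-> J f.

Definition zero_ideal : S -> Prop := fun f => f = 0.

Definition ideal_gen (A : S -> Prop) : S -> Prop := fun f =>
  exists s : seq (S * S),
    (forall p, p \in s -> A p.2) /\ f = \sum_(p <- s) p.1 * p.2.

Definition ideal_add I J : S -> Prop := fun f =>
  exists g h, [/\ I g, J h & f = g + h].

Definition ideal_mul I J : S -> Prop :=
  ideal_gen (fun f => exists g h, [/\ I g, J h & f = g * h]).

Definition ideal_scale g I : S -> Prop := fun f =>
  exists2 h, I h & f = g * h.

Definition var_ideal (s : seq 'I_n) : S -> Prop :=
  ideal_gen (fun f => exists2 i, i \in s & f = 'X_i).

Definition monomial_ideal I : Prop :=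
  exists A : 'X_{1..n} -> Prop,
    ideal_eq I (ideal_gen (fun f => exists2 u, A u & f = 'X_[u])).

Definition generated_in_degree I (d : nat) : Prop :=
  ideal_eq I (ideal_gen (fun f => I f /\ f \is d.-homog)).

(* Minimal monomial generators: the monomials of I which are minimal with     *)
(* respect to divisibility.                                                   *)
Definition min_gen I u : Prop :=
  I 'X_[u] /\ forall v, (v <= u)%MM -> I 'X_[v] -> v = u.

Definition polymatroidal I : Prop :=
  [/\ monomial_ideal I,
      exists d, generated_in_degree I d
    & forall u v, min_gen I u -> min_gen I v ->
        forall i, (v i < u i)%N ->
        exists2 j, (u j < v j)%N & min_gen I (u - U_(i) + U_(j))%MM].

Definition msupport u : {set 'I_n} := [set i | u i != 0%N].

Definition matching_power I (k : nat) : S -> Prop :=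
  ideal_gen (fun f => exists u : 'I_k -> 'X_{1..n},
    [/\ forall i, I 'X_[u i],
        forall i j, i != j -> [disjoint msupport (u i) & msupport (u j)]
      & f = \prod_(i < k) 'X_[u i]]).

End Ideals.

(* Graded free resolutions ... -> F_1 -> F_0 -> I -> 0, where                 *)
(* F_i = \bigoplus_(k < rk i) S(- shift k).  The elements of F_i are row      *)
(* vectors, on which the maps act by right multiplication.                    *)

Record graded_free_data (K : fieldType) (n : nat) := GradedFreeData {
  rk : nat -> nat;
  shift : forall i, 'I_(rk i) -> nat;
  diff : forall i, 'M[{mpoly K[n]}]_(rk i.+1, rk i);
  aug : 'cV[{mpoly K[n]}]_(rk 0)
}.

Section Resolutions.
Variables (K : fieldType) (n : nat).
Local Notation S := {mpoly K[n]}.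
Implicit Types (I : S -> Prop) (F : graded_free_data K n).

(* f is the matrix entry of a degree 0 map S(-a) -> S(-b). *)
Definition degree0_entry (a b : nat) (f : S) : Prop :=
  if (a < b)%N then f = 0 else f \is (a - b).-homog.

Definition graded_free_resolution I F : Prop :=
  [/\ forall k, aug F k 0 \is (shift k).-homog,
      forall i (k : 'I_(rk F i.+1)) (l : 'I_(rk F i)),
        degree0_entry (shift k) (shift l) (diff F i k l),
      forall f, I f <-> exists v : 'rV_(rk F 0), (v *m aug F) 0 0 = f,
      forall v : 'rV_(rk F 0),
        v *m aug F = 0 <-> exists w, v = w *m diff F 0
    & forall i (v : 'rV_(rk F i.+1)),
        v *m diff F i = 0 <-> exists w, v = w *m diff F i.+1].

(* The image of F_(i+1) lies in (x_1, ..., x_n) F_i. *)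
Definition minimal F : Prop := forall i k l, (diff F i k l)@_0%MM = 0.

Definition minimal_graded_free_resolution I F : Prop :=
  graded_free_resolution I F /\ minimal F.

(* The graded Betti number beta_(i, j): the rank of S(-j) in F_i.  The        *)
(* minimal graded free resolution of a graded ideal exists and is unique up   *)
(* to isomorphism, so this only depends on the ideal when F is minimal.       *)
Definition betti F (i j : nat) : nat := #|[set k : 'I_(rk F i) | shift k == j]|.

Definition linearly_related I : Prop :=
  exists d, generated_in_degree I d /\
  exists F, minimal_graded_free_resolution I F /\
    forall j, j <> d.+1 -> betti F 1 j = 0%N.

Definition linear_resolution I : Prop :=
  exists d, generated_in_degree I d /\
  exists F, minimal_graded_free_resolution I F /\
    forall i j, j <> (d + i)%N -> betti F i j = 0%N.

End Resolutions.

Section EdgeIdeals.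
Variables (K : fieldType) (n : nat).
Local Notation S := {mpoly K[n]}.

Definition edge_ideal (e : rel 'I_n) : S -> Prop :=
  ideal_gen (fun f => exists i j, e i j /\ f = 'X_i * 'X_j).

Definition wo_edge_ideal (D : wograph n) : S -> Prop :=
  ideal_gen (fun f => exists i j, arc D i j /\ f = 'X_i * 'X_j ^+ wt D j).

(* The generator attached to the edge {a, b}; only meaningful when a and b    *)
(* are adjacent, in which case it does not depend on their order.             *)
Definition edge_monomial (D : wograph n) (a b : 'I_n) : S :=
  if arc D a b then 'X_a * 'X_b ^+ wt D b else 'X_b * 'X_a ^+ wt D a.

Definition wo_matching_power (D : wograph n) (k : nat) : S -> Prop :=
  matching_power (wo_edge_ideal D) k.

End EdgeIdeals.

Arguments zero_ideal K n f : clear implicits.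
Arguments var_ideal K [n] s f.
Arguments edge_ideal K [n] e f.
Arguments wo_edge_ideal K [n] D f.
Arguments edge_monomial K [n] D a b.
Arguments wo_matching_power K [n] D k f.

(* Main.v *)
(** Write u_M for the generator of I(D)^[k] attached to a k-matching M. In a
    forest a matching is determined by the set of vertices it covers, so no
    generator divides another one. For k = nu(G), an exchange
    u -> u x_j / x_i between generators has to change the support; hence
    polymatroidality is equivalent to the condition [constant_exponents]: a
    vertex has the same exponent in all the generators it divides, and this
    exponent is 1 unless it divides all of them (the exchange of the supports is
    the one of the matching matroid).

    If I is linearly related, its generators are connected by steps
    u -> u x_j / x_i, and following such a path shows that the exponents are
    constant. A polymatroidal ideal has linear quotients, and iterated mapping
    cones then give a linear resolution. Finally the end of a longest path of the
    forest provides an isolated edge or a distant configuration, and both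
    directions of the equivalence with (d) are checked on exponents. *)

Require Import Defs.
From mathcomp Require Import all_boot all_order all_algebra.
From mathcomp Require Import mpoly.

Set Implicit Arguments.
Unset Strict Implicit.
Unset Printing Implicit Defensive.

Import Order.TTheory GRing.Theory.
Local Open Scope ring_scope.

(** * Monomial ideals, membership through supports, minimal generators *)

Section MonomialIdeals.
Variables (K : fieldType) (n : nat).
Local Notation S := {mpoly K[n]}.
Implicit Types (I J Q : S -> Prop) (f g h : S) (u v m : 'X_{1..n}).
Implicit Types (A B : 'X_{1..n} -> Prop).

(** What separates (d-2) from (d-3) is the weight of a leaf a of the configuration. If some maximum
    matching misses a, constancy forces exponent 1 on a, hence w(a) = 1. If none does, then t = 1
    and {a,b} is strong, and w(a) is free because x_a divides every generator. In (d-3) the vertex b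
    is covered by every maximum matching and all its partners have weight 1. The cases (d-3-i) and
    (d-3-ii) record whether some maximum matching uses {b,c}: if so, replacing {b,c} by {a,b}
    uncovers c, and this gives w(c) = 1. On the algebraic side a resolution is an infinite sequence
    of explicit matrices. A mapping cone therefore needs a comparison map that is chosen recursively
    and kept homogeneous. Conversely, linear relations have to be read off an arbitrary minimal
    resolution, whose basis elements may be sent to combinations of several monomials; this is why
    the augmentation is cut into parts according to its monomials. *)

Definition is_ideal I : Prop :=
  [/\ I 0, forall f g, I f -> I g -> I (f + g) & forall f g, I g -> I (f * g)].

Lemma is_ideal_sum I T (r : seq T) (P : pred T) (F : T -> S) :
  is_ideal I -> (forall i, P i -> I (F i)) -> I (\sum_(i <- r | P i) F i).
Proof. by case=> I0 ID _ HF; apply: big_ind. Qed.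

Lemma is_ideal_sum_seq I (T : eqType) (r : seq T) (F : T -> S) :
  is_ideal I -> (forall i, i \in r -> I (F i)) -> I (\sum_(i <- r) F i).
Proof. by move=> Iid HF; rewrite big_seq; apply: is_ideal_sum. Qed.

Lemma ideal_gen_ideal (G : S -> Prop) : is_ideal (ideal_gen G).
Proof.
split.
- by exists [::]; rewrite big_nil.
- move=> _ _ [s1 [H1 ->]] [s2 [H2 ->]]; exists (s1 ++ s2); split.
    by move=> p; rewrite mem_cat => /orP[/H1|/H2].
  by rewrite big_cat.
- move=> f _ [s [Hs ->]]; exists [seq (f * p.1, p.2) | p <- s]; split.
    by move=> p /mapP[q /Hs ? ->].
  by rewrite big_map mulr_sumr; apply: eq_bigr => p _; rewrite mulrA.
Qed.

Lemma ideal_gen_in (G : S -> Prop) f : G f -> ideal_gen G f.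
Proof.
move=> Gf; exists [:: (1, f)]; split; last by rewrite big_seq1 mul1r.
by move=> p; rewrite inE => /eqP->.
Qed.

Lemma ideal_gen_min (G : S -> Prop) I :
  is_ideal I -> (forall f, G f -> I f) -> forall f, ideal_gen G f -> I f.
Proof.
move=> Iid HG _ [s [Hs ->]]; apply: is_ideal_sum_seq => // p ps.
by case: Iid => _ _; apply; apply: HG; apply: Hs.
Qed.

Lemma ideal_add_ideal I J : is_ideal I -> is_ideal J -> is_ideal (ideal_add I J).
Proof.
move=> [I0 ID IM] [J0 JD JM]; split.
- by exists 0, 0; rewrite addr0.
- move=> _ _ [g [h [Ig Jh ->]]] [g' [h' [Ig' Jh' ->]]].
  by exists (g + g'), (h + h'); rewrite addrACA; split; auto.
- move=> f _ [g [h [Ig Jh ->]]].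
  by exists (f * g), (f * h); rewrite mulrDr; split; auto.
Qed.

Lemma ideal_scale_ideal g I : is_ideal I -> is_ideal (ideal_scale g I).
Proof.
move=> [I0 ID IM]; split.
- by exists 0; rewrite ?mulr0.
- move=> _ _ [h Ih ->] [h' Ih' ->]; exists (h + h'); rewrite ?mulrDr //.
  exact: ID.
- by move=> f _ [h Ih ->]; exists (f * h); [apply: IM | rewrite mulrCA].
Qed.

(** The ideal generated by the monomials in [A], described by the supports of its elements so that
    membership is tested one monomial at a time; [ideal_gen_mono] identifies the two
    descriptions. *)
Definition mono A f : Prop :=
  forall m, m \in msupp f -> exists2 u, A u & (u <= m)%MM.

Lemma mono_ideal A : is_ideal (mono A).
Proof.
split.
- by move=> m; rewrite msupp0.
- by move=> f g If Ig m /msuppD_le; rewrite mem_cat => /orP[/If|/Ig].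
- move=> f g Ig m /msuppM_le /allpairsP[[m1 m2] /= [_ /Ig[u Au um] ->]].
  by exists u => //; apply: lepm_trans um _; apply: lem_addl.
Qed.

Lemma monoX A m : mono A 'X_[m] <-> exists2 u, A u & (u <= m)%MM.
Proof.
split; first by apply; rewrite msuppX mem_seq1.
by move=> H m'; rewrite msuppX mem_seq1 => /eqP->.
Qed.

Lemma mono_gen A u : A u -> mono A 'X_[u].
Proof. by move=> Au; apply/monoX; exists u => //; apply: lepm_refl. Qed.

Lemma mono_msupp A f m : mono A f -> m \in msupp f -> mono A 'X_[m].
Proof. by move=> Af /Af ?; apply/monoX. Qed.

Lemma lem_mulX I u m : is_ideal I -> I 'X_[u] -> (u <= m)%MM -> I 'X_[m].
Proof. by move=> [_ _ IM] Iu um; rewrite -(submK um) mpolyXD; apply: IM. Qed.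

Lemma mono_min A I f : is_ideal I -> (forall u, A u -> I 'X_[u]) ->
  mono A f -> I f.
Proof.
move=> Iid AI Af; rewrite (mpolyE f); apply: is_ideal_sum_seq => // m /Af[u Au um].
by rewrite -mul_mpolyC; case: (Iid) => _ _; apply; apply: lem_mulX um; auto.
Qed.

Lemma ideal_gen_mono A f :
  ideal_gen (fun g => exists2 u, A u & g = 'X_[u]) f <-> mono A f.
Proof.
split; last first.
  apply: mono_min; first exact: ideal_gen_ideal.
  by move=> u Au; apply: ideal_gen_in; exists u.
apply: ideal_gen_min; first exact: mono_ideal.
by move=> _ [u Au ->]; apply: mono_gen.
Qed.

Lemma monomial_idealP I : monomial_ideal I <-> exists A, ideal_eq I (mono A).
Proof.
split=> -[A IA]; exists A => f; rewrite IA; first exact: ideal_gen_mono.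
by rewrite ideal_gen_mono.
Qed.

Lemma ideal_eq_is_ideal I J : ideal_eq I J -> is_ideal J -> is_ideal I.
Proof.
move=> IJ [J0 JD JM]; split; first exact/IJ.
  by move=> f g /IJ ? /IJ ?; apply/IJ/JD.
by move=> f g /IJ ?; apply/IJ/JM.
Qed.

Lemma min_gen_generator A I u : ideal_eq I (mono A) -> min_gen I u -> A u.
Proof.
move=> IA [/IA/monoX[v Av vu] Hu].
by rewrite -(Hu v vu) //; apply/IA/mono_gen.
Qed.

Lemma min_genP A I u : ideal_eq I (mono A) ->
  (forall v w, A v -> A w -> (v <= w)%MM -> v = w) -> min_gen I u <-> A u.
Proof.
move=> IA anti; split; first exact: min_gen_generator.
move=> Au; split; first exact/IA/mono_gen.
move=> v vu /IA/monoX[w Aw wv].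
have wu : w = u by apply: anti => //; apply: lepm_trans vu.
apply/mnmP => i; apply/eqP; rewrite eqn_leq (mnm_lepP vu) /=.
by move: (mnm_lepP wv i); rewrite wu.
Qed.

(** Writing ['X_[u]] as a combination of elements of degree [d] shows that a monomial of [I] of
    degree [d] divides it; by minimality this monomial is [u]. *)
Lemma generated_in_degree_min_gen A I d u :
  ideal_eq I (mono A) -> generated_in_degree I d -> min_gen I u -> mdeg u = d.
Proof.
move=> IA Id [/[dup] Iu /Id[s [Hs Xu]] Hu].
have /msupp_sum_le/flattenP[/= l /mapP[p]] :
    u \in msupp (\sum_(p <- s) p.1 * p.2) by rewrite -Xu msuppX mem_seq1.
rewrite mem_filter /= => /Hs[Ip p2d] -> /msuppM_le.
case/allpairsP => -[m1 m2] /= [_ m2p um].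
have m2I : I 'X_[m2] by apply/IA; apply: mono_msupp m2p; apply/IA.
have m2u : m2 = u by apply: Hu => //; rewrite um lem_addl.
by rewrite -m2u; apply: (dhomogP _ _ _ p2d).
Qed.

Lemma generated_in_degree_mono A I d : ideal_eq I (mono A) ->
  (forall u, A u -> mdeg u = d) -> generated_in_degree I d.
Proof.
move=> IA Ad f; split.
  move/IA; apply: mono_min; first exact: ideal_gen_ideal.
  move=> u Au; apply: ideal_gen_in; split; first exact/IA/mono_gen.
  by rewrite dhomogX; apply/eqP/Ad.
apply: ideal_gen_min; first exact: ideal_eq_is_ideal IA (mono_ideal A).
by move=> g [].
Qed.

Lemma generated_in_degree_msupp A I d f m : ideal_eq I (mono A) ->
  generated_in_degree I d -> I f -> m \in msupp f ->
  exists2 u, I 'X_[u] & (mdeg u == d) && (u <= m)%MM.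
Proof.
move=> IA Id /Id[s [Hs ->]] /msupp_sum_le/flattenP[/= l /mapP[p]].
rewrite mem_filter /= => /Hs[Ip p2d] -> /msuppM_le.
case/allpairsP => -[m1 m2] /= [_ m2p ->]; exists m2.
  by apply/IA; apply: mono_msupp m2p; apply/IA.
by rewrite lem_addl andbT; apply/eqP/(dhomogP _ _ _ p2d).
Qed.

Lemma msupp_scaleX u f m : m \in msupp ('X_[u] * f) -> (u <= m)%MM.
Proof.
move/msuppM_le/allpairsP => [[m1 m2] /= [+ _ ->]].
by rewrite msuppX mem_seq1 => /eqP->; apply: lem_addr.
Qed.

End MonomialIdeals.

(** * Linear resolutions as sequences of matrices, and mapping cones *)

Section LinearResolutions.
Variables (K : fieldType) (n : nat).
Local Notation S := {mpoly K[n]}.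
Implicit Types (I J Q : S -> Prop) (f g h : S).

Lemma pihomogMr b e (p q : S) :
  q \is b.-homog -> pihomog mdeg (e + b) (p * q) = pihomog mdeg e p * q.
Proof.
move=> qa; rewrite [p in LHS](mpolyE p) [p in RHS](mpolyE p).
rewrite mulr_suml !raddf_sum mulr_suml; apply: eq_bigr => m _ /=.
rewrite -scalerAl !linearZ /= -scalerAl; congr (_ *: _).
have Xqh : 'X_[m] * q \is (mdeg m + b).-homog by rewrite dhomogM ?dhomogX.
rewrite pihomogX; have [<-|me] := eqVneq; first by rewrite (pihomog_dE Xqh).
by rewrite mul0r (pihomog_ne0 _ Xqh) // eqn_add2r.
Qed.

Definition homog_mx p q d (A : 'M[S]_(p, q)) : bool :=
  [forall k, forall l, A k l \is d.-homog].

Lemma homog_mxP p q d (A : 'M[S]_(p, q)) :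
  reflect (forall k l, A k l \is d.-homog) (homog_mx d A).
Proof. exact: 'forall_forallP. Qed.

Lemma homog_mulmx p q r d e (A : 'M[S]_(p, q)) (B : 'M[S]_(q, r)) :
  homog_mx d A -> homog_mx e B -> homog_mx (d + e) (A *m B).
Proof.
move=> /homog_mxP Ad /homog_mxP Be; apply/homog_mxP => k l.
by rewrite mxE rpred_sum // => i _; rewrite dhomogM.
Qed.

(** Exactness provides lifts without any control of degrees; the component of the right degree is
    still a lift. *)
Lemma homog_lift p q r d e (X : 'M[S]_(p, q)) (Y : 'M[S]_(p, r)) (B : 'M_(r, q)) :
  homog_mx (e + d) X -> homog_mx d B -> X = Y *m B ->
  X = map_mx (pihomog mdeg e) Y *m B.
Proof.
move=> /homog_mxP Xh /homog_mxP Bh XE; apply/matrixP => k l.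
rewrite -(pihomog_dE (Xh k l)) XE !mxE raddf_sum; apply: eq_bigr => i _ /=.
by rewrite pihomogMr // mxE.
Qed.

Lemma row_lift p q r s (X : 'M[S]_(p, q)) (A : 'M[S]_(q, r)) (B : 'M[S]_(s, q)) :
    (forall v : 'rV_q, v *m A = 0 -> exists w, v = w *m B) -> X *m A = 0 ->
  exists Y, X = Y *m B.
Proof.
move=> H XA.
have /fin_all_exists[w Hw] : forall k, exists w, row k X = w *m B.
  by move=> k; apply: H; rewrite -row_mul XA row0.
by exists (\matrix_k w k); apply/row_matrixP => k; rewrite row_mul rowK -Hw.
Qed.

(** The next term exists only under the invariant [P]. As [R] is boolean and each [T i] is a choice
    type, it is selected by [xchoose], without a choice axiom. *)
Lemma dependent_choice_seq (T : nat -> choiceType) (P : forall i, T i -> Prop)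
    (R : forall i, T i -> T i.+1 -> bool) (x0 : T 0) :
    P 0 x0 -> (forall i x, P i x -> exists y, R i x y) ->
    (forall i x y, P i x -> R i x y -> P i.+1 y) ->
  exists t : forall i, T i, t 0 = x0 /\ forall i, R i (t i) (t i.+1).
Proof.
move=> P0 PR RP.
pose step i (s : {x | P i x}) : {y | P i.+1 y} :=
  exist _ (xchoose (PR i _ (svalP s)))
          (RP i _ _ (svalP s) (xchooseP (PR i _ (svalP s)))).
pose t := nat_rect (fun i => {x | P i x}) (exist _ x0 P0) step.
by exists (fun i => sval (t i)); split=> // i /=; apply: xchooseP.
Qed.

(** Rank of the target of the map of index [i], the target of index 0 being S itself. With [aug_deg]
    it treats the augmentation and the differentials uniformly. *)
Definition aug_rk (rk : nat -> nat) i := if i is j.+1 then rk j else 1%N.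
Definition aug_deg d i := if i is _.+1 then 1%N else d.

(* The matrix of index 0 is the augmentation to S. *)
(* augmentation being the matrix of index 0.                                    *)
Definition linres d I : Prop :=
  exists rk (A : forall i, 'M[S]_(rk i, aug_rk rk i)),
  [/\ forall i, homog_mx (aug_deg d i) (A i),
      forall f, I f <-> exists v : 'rV_(rk 0), v *m A 0 = f%:M
    & forall i (v : 'rV_(rk i)),
        v *m A i = 0 <-> exists w : 'rV_(rk i.+1), v = w *m A i.+1].

Lemma linres_eq d I J : ideal_eq I J -> linres d J -> linres d I.
Proof.
by move=> IJ [rk [A [h1 h2 h3]]]; exists rk, A; split=> // f; rewrite IJ.
Qed.

Lemma linres0 d : linres d (fun f => f = 0).
Proof.
exists (fun=> 0%N), (fun i => 0); split.
- by move=> i; apply/homog_mxP => -[].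
- move=> f; split=> [->|[v]]; first by exists 0; rewrite mul0mx raddf0.
  by rewrite /= mulmx0 => /matrixP/(_ 0 0); rewrite !mxE.
- move=> i v; split=> [_|_]; last by rewrite /= mulmx0.
  by exists 0; apply/matrixP => ? [].
Qed.

(* Mapping cone of a lift theta of multiplication by u : S/Q -> S/J.            *)
Lemma linres_cone d I J Q u :
    linres d J -> linres 1 Q -> u \is d.-homog ->
    (forall f, J (f * u) <-> Q f) ->
    (forall f, I f <-> exists x g, J g /\ f = x * u + g) ->
  linres d I.
Proof.
move=> [rJ [A [Ah JA exA]]] [rQ [B [Bh QB exB]]] uh JuQ IJu.
have {}Bh i : homog_mx 1 (B i) by have := Bh i; case: i.
have AA i : A i.+1 *m A i = 0.
  apply/row_matrixP => k; rewrite row_mul row0; apply/exA.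
  by exists (delta_mx 0 k); rewrite rowE.
have BB i : B i.+1 *m B i = 0.
  apply/row_matrixP => k; rewrite row_mul row0; apply/exB.
  by exists (delta_mx 0 k); rewrite rowE.
(* The lift is made to anticommute with the differentials, so that the matrices of the cone carry no
   signs. Its first term [u] has degree [d]; all later terms are linear. *)
have [theta [theta0 thetaE]] : exists theta : forall i, 'M[S]_(aug_rk rQ i, aug_rk rJ i),
    theta 0 = u%:M /\ forall i,
    homog_mx 1 (theta i.+1) && (B i *m theta i + theta i.+1 *m A i == 0).
  apply: (@dependent_choice_seq
    (fun i => 'M[S]_(aug_rk rQ i, aug_rk rJ i) : choiceType)
    (fun i X => homog_mx (aug_deg d i) X /\ exists Y, B i *m X = Y *m A i)
    (fun i X Y => homog_mx 1 Y && (B i *m X + Y *m A i == 0))).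
  - split; first by apply/homog_mxP => k l; rewrite !ord1 mxE.
    have /fin_all_exists[w Hw] k : exists w, row k (B 0 *m u%:M) = w *m A 0.
      have [|w Hw] := (JA (B 0 k 0 * u)).1.
        apply/JuQ/QB; exists (delta_mx 0 k); rewrite -rowE.
        by apply/rowP => j; rewrite !ord1 !mxE.
      exists w; rewrite Hw; apply/rowP => j.
      by rewrite mul_mx_scalar !ord1 !mxE mulrC.
    exists (\matrix_k w k); apply/row_matrixP => k.
    by rewrite [RHS]row_mul rowK -Hw.
  - move=> i X [Xh [Y XY]].
    have Y'E := homog_lift (homog_mulmx (Bh i) Xh) (Ah i) XY.
    exists (- map_mx (pihomog mdeg 1) Y).
    rewrite mulNmx -Y'E subrr eqxx andbT; apply/homog_mxP => k l.
    by rewrite !mxE rpredN pihomogP.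
  - move=> i X Y [Xh _] /andP[Yh /eqP XY]; split=> //.
    apply: (row_lift (A := A i)); first by move=> v /exA.
    apply/eqP; rewrite -mulmxA -[Y *m _](addKr (B i *m X)) XY addr0.
    by rewrite mulmxN mulmxA BB mul0mx oppr0.
have th i : homog_mx (aug_deg d i) (theta i).
  case: i => [|i]; last by case/andP: (thetaE i).
  by rewrite theta0; apply/homog_mxP => k l; rewrite !ord1 mxE.
have {}thetaE i : B i *m theta i = - (theta i.+1 *m A i).
  by apply/eqP; rewrite -addr_eq0; case/andP: (thetaE i).
pose rI i := (aug_rk rQ i + rJ i)%N.
pose C i : 'M[S]_(rI i, aug_rk rI i) :=
  if i is j.+1 then block_mx (B j) (theta j.+1) 0 (A j.+1)
  else col_mx (theta 0) (A 0).
exists rI, C; split.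
- case=> [|i] /=; apply/homog_mxP => k l.
    by rewrite mxE; case: splitP => j _; apply/homog_mxP; [apply: (th 0) | apply: Ah].
  rewrite mxE; case: splitP => k' _; rewrite mxE; case: splitP => l' _.
  + by apply/homog_mxP; apply: Bh.
  + by apply/homog_mxP; apply: (th i.+1).
  + by rewrite mxE rpred0.
  + by apply/homog_mxP; apply: (Ah i.+1).
- move=> f; rewrite IJu; split=> [[x [g [/JA[w Hw] ->]]]|[v Hv]].
    exists (row_mx x%:M w); rewrite /C mul_row_col theta0 Hw -scalar_mxM.
    by rewrite -raddfD.
  rewrite /C -[v]hsubmxK mul_row_col theta0 in Hv.
  exists (lsubmx v 0 0), (((rsubmx v : 'rV_(rJ 0)) *m A 0) 0 0); split.
    by apply/JA; exists (rsubmx v); apply/rowP => j; rewrite !ord1 !mxE eqxx mulr1n.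
  move/matrixP/(_ 0 0): Hv; rewrite mul_mx_scalar [RHS]mxE eqxx mulr1n => <-.
  by rewrite mxE mxE mulrC.
- move=> i v; split.
    rewrite -[v]hsubmxK; set x := lsubmx v; set y := rsubmx v => xy0.
    (* The first component of a cycle is a boundary in the resolution of [Q]: by exactness in
       positive index, and in index 0 because [x * u] lies in [J], hence [x] in [Q]. Correcting [y]
       by the lift of [p] then leaves a cycle of [A]. *)
    have [p xp yp] : exists2 p : 'rV_(rQ i), x = p *m B i & x *m theta i + y *m A i = 0.
      case: i => [|i] in v x y xy0 *; last first.
        move: xy0; rewrite /C (@mul_row_block _ 1 (rQ i) (rJ i.+1)) mulmx0 addr0.
        by rewrite -[0](@row_mx0 S 1) => /eq_row_mx[/exB[p ->] ?]; exists p.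
      move: xy0; rewrite /C (@mul_row_col _ 1 1 (rJ 0)) => xy0.
      have [|p xp] := (QB (x 0 0)).1; last first.
        exists p => //; rewrite xp; apply/rowP => j.
        by rewrite !ord1 [RHS]mxE eqxx mulr1n.
      apply/JuQ/JA; exists (- y); rewrite mulNmx.
      move/eqP: xy0; rewrite addrC addr_eq0 theta0 => /eqP->; rewrite opprK.
      by apply/rowP => j; rewrite mul_mx_scalar !ord1 !mxE eqxx mulr1n mulrC.
    have /exA[q yq] : (y - p *m theta i.+1) *m A i = 0.
      rewrite mulmxBl -(mulmxA p) -[theta i.+1 *m _]opprK -thetaE mulmxN opprK.
      by rewrite mulmxA -xp addrC.
    exists (row_mx p q); rewrite /C mul_row_block mulmx0 addr0 -xp -yq.
    by rewrite addrC subrK.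
  case=> w ->; rewrite -mulmxA; apply/eqP; rewrite -[X in _ == X](mulmx0 _ w).
  apply/eqP; congr (_ *m _).
  case: i {v w} => [|i]; rewrite /C.
    by rewrite mul_block_col mul0mx add0r thetaE AA addNr col_mx0.
  rewrite mulmx_block BB !mul0mx !mulmx0 !addr0 add0r.
  by rewrite thetaE AA addNr ?add0r block_mx_const.
Qed.

End LinearResolutions.

(** * Linear quotients, and linear resolutions of polymatroidal ideals *)

Section LinearQuotients.
Variables (K : fieldType) (n : nat).
Local Notation S := {mpoly K[n]}.
Implicit Types (I J Q : S -> Prop) (f g h : S) (u v w m : 'X_{1..n}).

(** Minimality is automatic, since linear forms have no constant coefficient. *)
Lemma linres_linear_resolution d I :
  generated_in_degree I d -> linres d I -> linear_resolution I.
Proof.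
move=> Id [rI [A [Ah IA exA]]]; exists d; split=> //.
exists (@GradedFreeData K n rI (fun i _ => d + i)%N (fun i => A i.+1) (A 0)).
split; last first.
  move=> i j ij; apply/eqP; rewrite /betti cards_eq0; apply/eqP/setP => k.
  by rewrite !inE /=; apply/eqP => /esym.
split; last first.
  move=> i k l /=; apply: (dhomog_nemf_coeff (d := 1)); last by rewrite mf0.
  by have /homog_mxP := Ah i.+1.
split=> /=.
- by move=> k; rewrite addn0; have /homog_mxP := Ah 0.
- move=> i k l; rewrite /degree0_entry ltn_add2l ltnNge leqnSn /=.
  by rewrite addnS subSn // subnn; have /homog_mxP := Ah i.+1.
- move=> f; rewrite IA; split=> -[v Hv]; exists v.
    by rewrite Hv mxE eqxx mulr1n.
  by apply/rowP => j; rewrite !ord1 Hv mxE eqxx mulr1n.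
- exact: exA.
- by move=> i; apply: (exA i.+1).
Qed.

Lemma lem_mdeg_eq u v : (u <= v)%MM -> (mdeg v <= mdeg u)%N -> u = v.
Proof.
move=> uv; rewrite -{1}(submK uv) mdegD -{2}[mdeg u]add0n leq_add2r leqn0.
by rewrite mdeg_eq0 -{2}(submK uv) => /eqP->; rewrite add0m.
Qed.

Lemma mono_adjoin (A C : 'X_{1..n} -> Prop) u : (forall m, C m <-> A m \/ m = u) ->
  forall f, mono C f <-> exists x g, mono A g /\ f = x * 'X_[u] + g :> S.
Proof.
move=> CAu f; split; last first.
  move=> [x [g [Ag ->]]]; have [_ CD CM] := mono_ideal K C.
  apply: CD; first by apply/CM/mono_gen/CAu; right.
  by move=> m /Ag[w Aw wm]; exists w => //; apply/CAu; left.
apply: (mono_min (I := fun f => exists x g, mono A g /\ f = x * 'X_[u] + g)).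
  split.
  - exists 0, 0; rewrite mul0r addr0; split=> //.
    by case: (mono_ideal K A).
  - move=> _ _ [x [g [Ag ->]]] [x' [g' [Ag' ->]]]; exists (x + x'), (g + g').
    rewrite mulrDl addrACA; split=> //.
    by case: (mono_ideal K A) => _ AD _; apply: AD.
  - move=> y _ [x [g [Ag ->]]]; exists (y * x), (y * g).
    rewrite mulrDr mulrA; split=> //.
    by case: (mono_ideal K A) => _ _; apply.
move=> m /CAu[Am|->].
  by exists 0, 'X_[m]; rewrite mul0r add0r; split=> //; apply: mono_gen.
by exists 1, 0; rewrite mul1r addr0; split=> //; case: (mono_ideal K A).
Qed.

(** Multiplication by a monomial translates supports, so that the colon ideal by ['X_[u]] is
    determined on monomials. *)
Lemma monoMX (A B : 'X_{1..n} -> Prop) u :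
    (forall m, (exists2 w, A w & (w <= m + u)%MM) <->
               (exists2 w, B w & (w <= m)%MM)) ->
  forall f, mono A (f * 'X_[u] : S) <-> mono B f.
Proof.
move=> AB f; split=> Hf m mf.
  by apply/AB/Hf; rewrite (perm_mem (msuppMX f u)) addmC map_f.
move: mf; rewrite (perm_mem (msuppMX f u)) => /mapP[m' /Hf m'f ->].
by rewrite addmC; apply/AB.
Qed.

Lemma linres_nil d (A : 'X_{1..n} -> Prop) :
  (forall u, ~ A u) -> linres d (mono (K := K) A).
Proof.
move=> A0; apply: linres_eq (linres0 K n d) => f; split.
  move=> Af; apply/eqP; rewrite -msupp_eq0.
  case E: (msupp f) => [//|m s].
  by have [|u /A0] := Af m; rewrite ?E ?mem_head.
by move=> ->; case: (mono_ideal K A).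
Qed.

Definition vars (s : seq 'I_n) : 'X_{1..n} -> Prop :=
  fun u => exists2 i, i \in s & u = U_(i)%MM.

Lemma vars_dvd (s : seq 'I_n) m :
  (exists2 u, vars s u & (u <= m)%MM) <-> (exists2 i, i \in s & (0 < m i)%N).
Proof.
split=> [[_ [i si ->]]|[i si mi]]; first by rewrite lep1mP -lt0n; exists i.
by exists U_(i)%MM; [exists i | rewrite lep1mP -lt0n].
Qed.

(** A Koszul resolution, obtained by adjoining the variables one at a time: a new variable is a
    nonzerodivisor modulo the others, so the colon ideal is [mono (vars s)] again. *)
Lemma linres_vars (s : seq 'I_n) : uniq s -> linres 1 (mono (K := K) (vars s)).
Proof.
elim: s => [_|x s IH /= /andP[xs /IH Hs]]; first by apply: linres_nil => u [].
apply: (linres_cone Hs Hs (u := 'X_x)).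
- by rewrite dhomogX; apply/eqP/mdeg1.
- apply: monoMX => m; rewrite !vars_dvd; split=> -[i si mi]; exists i => //.
    move: mi; rewrite mnmDE mnm1E; case: eqP => [xi|_]; last by rewrite addn0.
    by rewrite xi si in xs.
  by rewrite mnmDE addn_gt0 mi.
- apply: (mono_adjoin (A := vars s) (C := vars (x :: s))) => m; split.
    case=> i; rewrite inE => /orP[/eqP->|si] ->; first by right.
    by left; exists i.
  case=> [[i si ->]|->]; first by exists i; rewrite ?inE ?si ?orbT.
  by exists x; rewrite ?mem_head.
Qed.

(** The third hypothesis says that the colon ideal of the generators below [u] by [u] is generated
    by variables: each smaller [v] brings a variable that divides v / gcd(u, v) and multiplies [u]
    into the ideal of the smaller generators. The last generator is then attached by a mapping
    cone. *)
Lemma linres_quotients d (s : seq 'X_{1..n}) :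
    sorted <%O s -> (forall u, u \in s -> mdeg u = d) ->
    (forall u v, u \in s -> v \in s -> (v < u)%O ->
      exists j w, [/\ (u j < v j)%N, w \in s, (w < u)%O & (w <= u + U_(j))%MM]) ->
  linres d (mono (K := K) (fun u => u \in s)).
Proof.
elim/last_ind: s => [_ _ _|s u IH sorted_s sd exch]; first exact: linres_nil.
have us v : v \in s -> (v < u)%O.
  move: sorted_s; rewrite -rev_sorted rev_rcons /= (path_sortedE) => [/andP[/allP H _]|].
    by rewrite -mem_rev => /H.
  by move=> x y z /= yx zy; apply: lt_trans yx.
have us' : u \notin s by apply/negP => /us; rewrite ltxx.
have Hs : linres d (mono (K := K) (fun u => u \in s)).
  apply: IH.
  - by move: sorted_s; case: (s) => //= x t; rewrite rcons_path => /andP[].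
  - by move=> v vs; apply: sd; rewrite mem_rcons inE vs orbT.
  - move=> v v' vs v's v'v.
    have [||//|j [w [jv ws wv wj]]] := exch v v'.
    + by rewrite mem_rcons inE vs orbT.
    + by rewrite mem_rcons inE v's orbT.
    exists j, w; split=> //; move: ws; rewrite mem_rcons inE => /orP[/eqP wu|//].
    by move: (lt_trans wv (us _ vs)); rewrite wu ltxx.
pose t := [seq j <- enum 'I_n | has (fun w => (w <= u + U_(j))%MM) s].
apply: (linres_cone Hs (linres_vars (s := t) _) (u := 'X_[u])).
- by rewrite filter_uniq ?enum_uniq.
- by rewrite dhomogX; apply/eqP/sd; rewrite mem_rcons mem_head.
- apply: monoMX => m; rewrite vars_dvd; split=> [[v vs vm]|[j]].
    have [|||j [w [uv ws wu wj]]] := exch u v.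
    + by rewrite mem_rcons mem_head.
    + by rewrite mem_rcons inE vs orbT.
    + exact: us.
    exists j; last first.
      move: (mnm_lepP vm j); rewrite mnmDE => /(leq_trans uv).
      by rewrite -{1}[u j]add0n ltn_add2r.
    rewrite mem_filter mem_enum andbT; apply/hasP; exists w => //.
    by move: ws; rewrite mem_rcons inE => /orP[/eqP wu'|//]; rewrite wu' ltxx in wu.
  rewrite mem_filter => /andP[/hasP[w ws wj] _] mj; exists w => //.
  apply: lepm_trans wj _; rewrite addmC; apply/mnm_lepP => i; rewrite !mnmDE leq_add2r.
  by rewrite mnm1E; case: eqP => // <-.
- apply: (mono_adjoin (A := fun v => v \in s)) => m; rewrite mem_rcons inE; split.
    by case/orP=> [/eqP|]; auto.
  by case=> ->; rewrite ?eqxx ?orbT.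
Qed.

(* Along the degree lexicographic order the generators have linear quotients:   *)
(* if v < u and i is the first index where they differ, then v i < u i, and the *)
(* exchange property at i replaces u by the smaller u - U_(i) + U_(j), j > i.   *)
Lemma polymatroidal_linear_resolution I (s : seq 'X_{1..n}) :
  ideal_eq I (mono (fun u => u \in s)) -> polymatroidal I -> linear_resolution I.
Proof.
move=> Is [_ [d Id] exch].
(* The list [s] may contain redundant generators of larger degree; those of degree [d] generate the
   ideal and form an antichain. *)
pose t := sort <=%O (undup [seq u <- s | mdeg u == d]).
have tE u : (u \in t) = (u \in s) && (mdeg u == d).
  by rewrite mem_sort mem_undup mem_filter andbC.
have It : ideal_eq I (mono (fun u => u \in t)).
  move=> f; rewrite Is; split; last first.
    by move=> Hf m /Hf[u]; rewrite tE => /andP[us _] um; exists u.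
  apply: mono_min (mono_ideal K _) _ => u us; apply/monoX.
  have [||w Iw /andP[/eqP wd wu]] := generated_in_degree_msupp (m := u) (f := 'X_[u]) Is Id.
  - exact/Is/mono_gen.
  - by rewrite msuppX mem_head.
  move/Is/monoX: (Iw) => [w' w's w'w]; exists w'; last exact: lepm_trans wu.
  have [||w'' _ /andP[/eqP w''d w''w']] :=
    generated_in_degree_msupp (m := w') (f := 'X_[w']) Is Id.
  - exact/Is/mono_gen.
  - by rewrite msuppX mem_head.
  have w''w : w'' = w.
    by apply: lem_mdeg_eq; [apply: lepm_trans w'w | rewrite wd w''d].
  rewrite tE w's; suff -> : w' = w by rewrite wd eqxx.
  apply/mnmP => i; apply/eqP; rewrite eqn_leq (mnm_lepP w'w) -w''w.
  exact: (mnm_lepP w''w').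
have genP u : min_gen I u <-> u \in t.
  apply: (min_genP (A := fun u => u \in t) _ It) => v w; rewrite !tE.
  by move=> /andP[_ /eqP vd] /andP[_ /eqP wd] vw; apply: lem_mdeg_eq; rewrite ?vd ?wd.
apply: (linres_linear_resolution Id); apply: linres_eq It _.
apply: linres_quotients => [|u|u v /genP Gu /genP Gv vu].
- by rewrite sort_lt_sorted undup_uniq.
- by rewrite tE => /andP[_ /eqP].
have vud : mdeg v = mdeg u.
  by rewrite !(generated_in_degree_min_gen Is Id).
have /(ltmcP vud)[i eq_lt lt_i] := vu.
have [j uvj /genP Gw] := exch _ _ Gu Gv _ lt_i.
have ij : (i < j)%N.
  rewrite ltnNge leq_eqVlt; apply/negP => /orP[/eqP/val_inj ji|/eq_lt ji].
    by rewrite ji in uvj; move: (ltn_trans uvj lt_i); rewrite ltnn.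
  by rewrite ji ltnn in uvj.
exists j, (u - U_(i) + U_(j))%MM; split=> //; last first.
  by apply/mnm_lepP => k; rewrite !mnmDE mnmBE leq_add2r leq_subr.
have ui : (U_(i) <= u)%MM by rewrite lep1mP -lt0n (leq_ltn_trans _ lt_i).
rewrite -{2}(submK ui) addmC [X in (_ < X)%O]addmC ltmc_add2l.
apply/ltmcP; first by rewrite !mdeg1.
exists i => [k ki|]; rewrite !mnm1E ?eqxx.
  by case: eqP => [jk|_]; [rewrite -jk ltnNge (ltnW ij) in ki |
    case: eqP => // ik; rewrite ik ltnn in ki].
by case: eqP => // ji; rewrite ji ltnn in ij.
Qed.

End LinearQuotients.

(** * Connectedness of the generators of a linearly related ideal *)

Section LinearRelations.
Variables (K : fieldType) (n : nat).
Local Notation S := {mpoly K[n]}.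
Implicit Types (I : S -> Prop) (f : S) (g h u v w m : 'X_{1..n}).
Implicit Types (A : 'X_{1..n} -> Prop) (C P : pred 'X_{1..n}).

Definition mpart P f : S := \sum_(m <- msupp f | P m) f@_m *: 'X_[m].

Lemma mpart_msupp P f m : m \in msupp (mpart P f) -> (m \in msupp f) && P m.
Proof.
move/msupp_sum_le/flattenP => [/= l /mapP[m']]; rewrite mem_filter => /andP[Pm' m'f].
by move=> -> /msuppZ_le; rewrite msuppX mem_seq1 => /eqP->; rewrite Pm' m'f.
Qed.

Lemma mpartC P f : mpart P f + mpart (predC P) f = f.
Proof. by rewrite [f in RHS]mpolyE (bigID P). Qed.

(** If no linear step leaves the class [C], every linear syzygy splits into a syzygy of the [C]-part
    of the augmentation and one of the complementary part. These syzygies generate all others, but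
    the relation between a generator [u] in [C] and a generator [v] outside [C] does not split. *)
Lemma linearly_related_connected A I C u v :
    ideal_eq I (mono A) -> linearly_related I ->
    (forall g h s t, A g -> A h -> (g + U_(s) = h + U_(t))%MM -> C g -> C h) ->
  min_gen I u -> min_gen I v -> C u -> C v.
Proof.
move=> IA [d [Id [F [[[augh diffh IF ex0 _] Fmin] b1]]]] closedC Gu Gv Cu.
apply/negPn/negP => nCv.
have [ud vd] := (generated_in_degree_min_gen IA Id Gu,
                 generated_in_degree_min_gen IA Id Gv).
have aI k : I (aug F k 0) by apply/IF; exists (delta_mx 0 k); rewrite -rowE mxE.
have a_ge k m : m \in msupp (aug F k 0) -> (d <= mdeg m)%N.
  case/(generated_in_degree_msupp IA Id (aI k)) => w _ /andP[/eqP<- wm].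
  by rewrite -(submK wm) mdegD leq_addl.
have a_gen k m : m \in msupp (aug F k 0) -> mdeg m = d -> A m.
  move=> mk md; have /monoX[w Aw wm] := mono_msupp (proj1 (IA _) (aI k)) mk.
  suff <- : w = m by [].
  apply: lem_mdeg_eq => //; rewrite md.
  have [||w' _ /andP[/eqP<- w'w]] := generated_in_degree_msupp (m := w) (f := 'X_[w]) IA Id.
  - exact/IA/mono_gen.
  - by rewrite msuppX mem_head.
  - by rewrite -(submK w'w) mdegD leq_addl.
pose aP P : 'cV[S]_(rk F 0) := \col_k mpart P (aug F k 0).
have aPC P : aP P + aP (predC P) = aug F.
  by apply/colP => k; rewrite !mxE mpartC.
have aP_low P (w : 'rV_(rk F 0)) m :
    m \in msupp ((w *m aP P) 0 0) -> mdeg m = d -> P m.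
  rewrite mxE => /msupp_sum_le/flattenP[/= l /mapP[k _ ->]].
  move=> /msuppM_le/allpairsP[[m1 m2] /= [_ + ->]]; rewrite mxE.
  move=> /mpart_msupp/andP[/a_ge m2d Pm2]; rewrite mdegD => m12.
  suff /eqP-> : m1 == 0%MM by rewrite add0m.
  by rewrite -mdeg_eq0 -leqn0 -(leq_add2r (mdeg m2)) m12.
(* The row has degree [d.+1], its nonzero entries have positive degree by minimality, and the
   augmentation has no monomial of degree below [d]: hence the first factor is a variable and the
   second a generator of degree [d]. *)
have aP_lin P j m : m \in msupp ((row j (diff F 0) *m aP P) 0 0) ->
    exists g t, [/\ m = (g + U_(t))%MM, A g & P g].
  rewrite mxE => /msupp_sum_le/flattenP[/= l /mapP[k _ ->]].
  move=> /msuppM_le/allpairsP[[m1 m2] /= [+ + ->]]; rewrite !mxE => m1k.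
  move=> /mpart_msupp/andP[m2k Pm2].
  have jd : shift j = d.+1.
    apply/eqP; apply/negP => /negP/eqP/(b1 _)/eqP.
    by rewrite /betti cards_eq0 => /eqP/setP/(_ j); rewrite !inE eqxx.
  have m2d := dhomogP _ _ _ (augh k) _ m2k; rewrite /= in m2d.
  have m1_nz : (0 < mdeg m1)%N.
    rewrite lt0n mdeg_eq0; apply/eqP => m10; move: m1k.
    by rewrite m10 mcoeff_msupp Fmin eqxx.
  move: (diffh 0 j k); rewrite /degree0_entry jd; case: ltnP => [_ d0|kd].
    by move: m1k; rewrite d0 msupp0.
  move=> /dhomogP/(_ _ m1k) /= m1d; have dk := a_ge _ _ m2k.
  have kd' : shift k = d.
    apply/eqP; rewrite eqn_leq -{2}m2d dk andbT.
    by rewrite m1d subn_gt0 ltnS in m1_nz.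
  move: m1d; rewrite kd' subSnn => /eqP/mdeg1P[t /eqP m1t].
  exists m2, t; rewrite m1t addmC; split=> //.
  by apply: a_gen m2k _; rewrite m2d.
(* A monomial of the [C]-part would have to cancel against the complementary part. It would then be
   a variable times a generator in [C] and also a variable times a generator outside [C], against
   [closedC]. *)
have dC0 : diff F 0 *m aP C = 0.
  apply/colP => j; apply/eqP; rewrite [X in _ == X]mxE -msupp_eq0.
  have rowj P : (diff F 0 *m aP P) j 0 = (row j (diff F 0) *m aP P) 0 0.
    by rewrite !mxE; apply: eq_bigr => k _; rewrite !mxE.
  rewrite rowj; case E: (msupp _) => [//|m l].
  have /aP_lin[g [s [mg Ag Cg]]] : m \in msupp ((row j (diff F 0) *m aP C) 0 0).
    by rewrite E mem_head.
  have /aP_lin[h [t [mh Ah /negP[]]]] :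
      m \in msupp ((row j (diff F 0) *m aP (predC C)) 0 0).
    have /eqP : row j (diff F 0) *m aug F = 0.
      by apply/ex0; exists (delta_mx 0 j); rewrite -rowE.
    rewrite -(aPC C) mulmxDr addrC addr_eq0 => /eqP->.
    by rewrite mxE (perm_mem (msuppN _)) E mem_head.
  by apply: (closedC g h s t) => //; rewrite -mg -mh.
have [[wu Hu] [wv Hv]] := ((IF _).1 (proj1 Gu), (IF _).1 (proj1 Gv)).
have /ex0[w Hw] : ('X_[v] *: wu - 'X_[u] *: wv) *m aug F = 0.
  rewrite mulmxBl -!scalemxAl [wu *m _]mx11_scalar [wv *m _]mx11_scalar Hu Hv.
  by rewrite !scale_scalar_mx mulrC subrr.
have /eqP : ('X_[v] *: wu - 'X_[u] *: wv) *m aP C = 0.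
  by rewrite Hw -mulmxA dC0 mulmx0.
rewrite mulmxBl -!scalemxAl subr_eq0 => /eqP/matrixP/(_ 0 0).
(* In degree [u + v], the coefficient of [u] in the [C]-part of its expression equals that of [v] in
   the [C]-part of its own. The latter is 0 as [v] is outside [C], while the former is the full
   coefficient 1 of [u]. *)
rewrite [LHS]mxE [RHS]mxE => /(congr1 (mcoeff (u + v)%MM)).
rewrite mulrC [in LHS]addmC mcoeffMX mulrC mcoeffMX => uv.
have /memN_msupp_eq0 v0 : v \notin msupp ((wv *m aP C) 0 0).
  by apply/negP => /aP_low/(_ vd) Cv; rewrite Cv in nCv.
have /memN_msupp_eq0 u0 : u \notin msupp ((wu *m aP (predC C)) 0 0).
  by apply/negP => /aP_low/(_ ud)/negP; apply.
have : ('X_[u] : S)@_u = 0.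
  by rewrite -Hu -(aPC C) mulmxDr mxE mcoeffD u0 addr0 uv v0.
by rewrite mcoeffX eqxx => /eqP; rewrite oner_eq0.
Qed.

End LinearRelations.

(** * The exchange property of the matching matroid *)

Section MatchingExchange.
Local Open Scope nat_scope.
Variable T : finType.
Implicit Types (A B : {set T}) (E M N P : {set {set T}}) (i j : T).

(** Relative to an arbitrary set of edges, because the induction in [matching_exchange] passes to a
    smaller one. *)
Definition matching_in E M : bool := (M \subset E) && trivIset M.

Lemma card2_pair A i : #|A| = 2 -> i \in A -> exists2 j, j != i & A = [set i; j].
Proof.
move=> A2 iA; have /eqP/cards1P[j Aj] : #|A :\ i| = 1.
  by move: A2; rewrite (cardsD1 i) iA => -[].
have : j \in A :\ i by rewrite Aj set11.
by rewrite !inE => /andP[ji _]; exists j; rewrite // -(setD1K iA) Aj.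
Qed.

Lemma matching_inD1 E M A : matching_in E M -> A \in M ->
  [/\ matching_in E (M :\ A), #|M| = #|M :\ A|.+1 & cover (M :\ A) = cover M :\: A].
Proof.
case/andP=> ME tM AM; split; last 2 first.
- by rewrite (cardsD1 A M) AM.
- exact: coverD1.
apply/andP; split; first by apply: subset_trans ME; apply: subsetDl.
by apply: trivIsetS tM; apply: subsetDl.
Qed.

Lemma coverU1 A P : cover (A |: P) = A :|: cover P.
Proof.
apply/setP => x; rewrite inE; apply/bigcupP/orP => [[B]|[xA|/bigcupP[B BP xB]]].
- by rewrite !inE => /orP[/eqP-> | BP] xB; [left | right; apply/bigcupP; exists B].
- by exists A; rewrite // setU11.
- by exists B; rewrite // !inE BP orbT.
Qed.

Lemma mem_cover A M i : A \in M -> i \in A -> i \in cover M.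
Proof. by move=> AM iA; apply/bigcupP; exists A. Qed.

Lemma disjoint_cover A M B : [disjoint A & cover M] -> B \in M -> [disjoint A & B].
Proof. by move=> AM BM; apply: disjointWr AM; apply: bigcup_sup. Qed.

Lemma matching_inU1 E M A : {in E, forall B, #|B| = 2} -> matching_in E M ->
    A \in E -> [disjoint A & cover M] ->
  matching_in E (A |: M) /\ #|A |: M| = #|M|.+1.
Proof.
move=> E2 /andP[ME tM] AE AM.
have [tAM AnM] : trivIset (A |: M) /\ A \notin M.
  apply: trivIsetU1 => //; first by move=> B; apply: disjoint_cover.
  by apply/negP => /(subsetP ME)/E2; rewrite cards0.
split; last by rewrite cardsU1 AnM.
by rewrite /matching_in tAM andbT subUset ME andbT sub1set.
Qed.

Lemma disjoint2 i j (A : {set T}) : [disjoint [set i; j] & A] = (i \notin A) && (j \notin A).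
Proof. by rewrite disjoints_subset subUset !sub1set !inE. Qed.

(* Follow the alternating path of M and N from i; deleting its first vertex and *)
(* the M-partner of that vertex keeps both matchings maximum.                   *)
Lemma matching_exchange k E M N i :
    {in E, forall B, #|B| = 2} -> (forall P, matching_in E P -> #|P| <= k) ->
    matching_in E M -> matching_in E N -> #|M| = k -> #|N| = k ->
    i \in cover M -> i \notin cover N ->
  exists j P, [/\ j \in cover N, j \notin cover M, matching_in E P, #|P| = k
                & cover P = j |: (cover M :\ i)].
Proof.
elim: k E M N i => [|k IH] E M N i E2 Ek mM mN Mk Nk iM iN.
  by move: iM; rewrite (cards0_eq Mk) /cover big_set0 inE.
have [A AM iA] := bigcupP iM.
have AE : A \in E by case/andP: mM => /subsetP/(_ _ AM).
have [y yi AE'] := card2_pair (E2 _ AE) iA.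
have yA : y \in A by rewrite AE' set22.
have yM : y \in cover M by apply: mem_cover AM yA.
have yN : y \in cover N.
  apply: contraT => yN; have [|mP Pk] := matching_inU1 E2 mN AE.
    by rewrite AE' disjoint2 iN.
  by have := Ek _ mP; rewrite Pk Nk ltnn.
have [B BN yB] := bigcupP yN.
have BE : B \in E by case/andP: mN => /subsetP/(_ _ BN).
have [z zy BE'] := card2_pair (E2 _ BE) yB.
have zB : z \in B by rewrite BE' set22.
have zN : z \in cover N by apply: mem_cover BN zB.
have zi : z != i by apply: contraNneq iN => <-.
have [mM1 cM1 covM1] := matching_inD1 mM AM.
have [mN1 cN1 covN1] := matching_inD1 mN BN.
(* If [M] misses [z], the alternating path ends here, and replacing [A] by [B] in [M] trades [i] for
   [z]. *)
have [zM|zM] := boolP (z \in cover M); last first.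
  have [|mP Pk] := matching_inU1 E2 mM1 BE.
    by rewrite BE' disjoint2 covM1 !inE yA (negbTE zM) andbF.
  exists z, (B |: (M :\ A)); split=> //; first by rewrite Pk -cM1.
  rewrite coverU1 covM1 BE' AE'; apply/setP => x; rewrite !inE.
  have [->|xz] := eqVneq x z; first by rewrite orbT.
  have [->|xy] := eqVneq x y; first by rewrite yi yM.
  by rewrite /= ?orbF.
(* Matchings avoiding [A] have at most [k] edges, since [A] can be added to them; so [M :\ A] and
   [N :\ B] are maximum among them, and the path continues from [z]. Adding [B] to the matching
   obtained there restores [y] and [z]. *)
pose E1 := [set X in E | [disjoint X & A]].
have inE1 P : matching_in E P -> [disjoint cover P & A] -> matching_in E1 P.
  case/andP=> PE tP PA; rewrite /matching_in tP andbT.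
  apply/subsetP => X XP; rewrite inE (subsetP PE _ XP) /= disjoint_sym.
  by apply: disjoint_cover XP; rewrite disjoint_sym.
have E1E P : matching_in E1 P -> matching_in E P /\ [disjoint A & cover P].
  case/andP=> /subsetP PE tP; split.
    by rewrite /matching_in tP andbT; apply/subsetP => X /PE; rewrite inE => /andP[].
  apply/bigcup_disjointP => X /PE; rewrite inE => /andP[_]; by rewrite disjoint_sym.
have [||||||||j [P1 [jN1 jM1 mP1 P1k covP1]]] := IH E1 (M :\ A) (N :\ B) z.
- by move=> X; rewrite inE => /andP[/E2].
- move=> P /E1E[mP PA]; have [mAP] := matching_inU1 E2 mP AE PA.
  by have := Ek _ mAP; move=> + cAP; rewrite cAP.
- by apply: inE1 => //; rewrite covM1 disjoint_sym disjoints_subset setCD subsetUr.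
- apply: inE1 => //; rewrite disjoint_sym AE' disjoint2 covN1 !inE yB /=.
  by rewrite (negbTE iN) andbF.
- by move: cM1; rewrite Mk => -[].
- by move: cN1; rewrite Nk => -[].
- by rewrite covM1 !inE AE' !inE negb_or zi zy.
- by rewrite covN1 !inE zB.
have [mP1' AP1] := E1E _ mP1.
move: jN1; rewrite covN1 inE => /andP[jB jN].
have [jy jz] : j != y /\ j != z.
  by split; apply: contraNneq jB => ->.
have ji : j != i by apply: contraNneq iN => <-.
have yP1 : y \notin cover P1 by rewrite (disjointFr AP1 yA).
have zP1 : z \notin cover P1 by rewrite covP1 !inE eq_sym (negbTE jz) eqxx.
have [|mP Pk] := matching_inU1 E2 mP1' BE; first by rewrite BE' disjoint2 yP1.
exists j, (B |: P1); split=> //.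
- by move: jM1; rewrite covM1 AE' !inE negb_or ji jy.
- by rewrite Pk P1k.
- rewrite coverU1 covP1 covM1 BE' AE'; apply/setP => x; rewrite !inE.
  have [->|xz] := eqVneq x z; first by rewrite zi zM !orbT.
  have [->|xy] := eqVneq x y; first by rewrite yi yM !orbT.
  by rewrite /= ?orbF.
Qed.

End MatchingExchange.

(** * Longest paths in forests, distant configurations, uniqueness of matchings *)

Section Forests.
Variables (n : nat) (e : rel 'I_n).
Hypotheses (e_sym : ssrbool.symmetric e) (e_irr : irreflexive e).
Implicit Types (a b c i j x y z : 'I_n) (M N : {set {set 'I_n}}).

Lemma set2_inj (i j k : 'I_n) : [set i; j] = [set i; k] -> j = k.
Proof.
move=> E; have : j \in [set i; k] by rewrite -E set22.
have : k \in [set i; j] by rewrite E set22.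
by rewrite !inE => /orP[]/eqP-> // /orP[]/eqP->.
Qed.

Lemma edgesP (E : {set 'I_n}) :
  reflect (exists a b, e a b /\ E = [set a; b]) (E \in edges e).
Proof.
rewrite inE; apply: (iffP existsP) => -[a].
  by case/existsP=> b /andP[ab /eqP->]; exists a, b.
by case=> b [ab ->]; exists a; apply/existsP; exists b; rewrite ab eqxx.
Qed.

Lemma mem_edges a b : ([set a; b] \in edges e) = e a b.
Proof.
apply/edgesP/idP => [[c [d [cd abcd]]]|ab]; last by exists a, b.
have : c \in [set a; b] by rewrite abcd set21.
rewrite !inE => /orP[/eqP ca|/eqP cb].
  by rewrite ca in abcd cd; rewrite (set2_inj abcd).
by rewrite cb setUC in abcd cd; rewrite (set2_inj abcd) e_sym.
Qed.

Lemma edges_card2 : {in edges e, forall E : {set 'I_n}, #|E| = 2%N}.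
Proof.
move=> _ /edgesP[a [b [ab ->]]]; rewrite cards2.
by case: eqP ab => // ->; rewrite e_irr.
Qed.

Lemma edge_partner E i : E \in edges e -> i \in E -> exists2 j, E = [set i; j] & e i j.
Proof.
move=> Ee iE; have [j _ Eij] := card2_pair (edges_card2 Ee) iE.
by exists j => //; rewrite -mem_edges -Eij.
Qed.

Lemma matching_partner M i : is_matching e M -> i \in cover M ->
  exists2 j, [set i; j] \in M & e i j.
Proof.
case/andP=> /subsetP Me _ /bigcupP[E EM iE].
by have [j Eij ij] := edge_partner (Me _ EM) iE; exists j; rewrite // -Eij.
Qed.

Lemma matching_partner_inj M i j k :
  is_matching e M -> [set i; j] \in M -> [set i; k] \in M -> j = k.
Proof.
case/andP=> _ /trivIsetP tM ijM ikM; apply: (@set2_inj i); apply/eqP.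
apply: contraT => /(tM _ _ ijM ikM)/pred0P/(_ i).
by rewrite /= !inE eqxx.
Qed.

Lemma forest_sub (r : rel 'I_n) : subrel r e -> forest e -> forest r.
Proof.
move=> re fe s s2 /andP[cs us]; apply: (fe s s2); rewrite /ucycle us andbT.
exact: sub_cycle cs.
Qed.

Lemma card_matching M : is_matching e M -> (#|M| <= matching_number e)%N.
Proof. by move=> mM; apply: (leq_bigmax_cond (F := fun M => #|M|)). Qed.

Hypothesis forest_e : forest e.

(** Otherwise the edge from [z] back to [x] closes a segment of the path into a cycle of length at
    least 3. *)
Lemma forest_path_neighbor x p z :
  path e x p -> uniq (x :: p) -> z \in p -> e z x -> z = head x p.
Proof.
move=> xp up zp zx; case/splitPr: zp xp up => -[//|y q r] xp up.
case: (forest_e (s := x :: rcons (y :: q) z)); first by rewrite /= size_rcons.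
move: xp up; rewrite -cat_rcons cat_path => /andP[xp _]; rewrite -cat_cons cat_uniq.
case/andP=> up _; rewrite /ucycle up andbT.
by change (path e x (rcons (rcons (y :: q) z) x)); rewrite rcons_path xp last_rcons.
Qed.

Definition longest_path x y p : Prop :=
  [/\ path e x (y :: p), uniq [:: x, y & p]
    & forall s, sorted e s -> uniq s -> (size s <= (size p).+2)%N].

Lemma exists_longest_path a b : e a b -> exists x y p, longest_path x y p.
Proof.
move=> ab; pose P k := [exists t : k.-tuple 'I_n, sorted e t && uniq t].
have P2 : P 2%N.
  apply/existsP; exists [tuple a; b]; rewrite /= ab /= inE andbT.
  by apply: contraL ab => /eqP->; rewrite e_irr.
have Pn k : P k -> (k <= n)%N.
  case/existsP=> t /andP[_ /card_uniqP]; rewrite size_tuple => <-.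
  by rewrite -[X in (_ <= X)%N]card_ord max_card.
have [k /existsP[t /andP[st ut]] kmax] := ex_maxnP (ex_intro (fun k => P k) _ P2) Pn.
have := kmax _ P2; rewrite -(size_tuple t).
case E: (tval t) st ut => [|x [|y p]] //= st ut _; exists x, y, p; split=> //.
move=> s ss us; have <- : size t = (size p).+2 by rewrite E.
rewrite size_tuple; apply: kmax.
by apply/existsP; exists (in_tuple s); rewrite ss us.
Qed.

(** A neighbour off the path would prolong it, and a neighbour on the path beyond [y] would close a
    cycle. *)
Lemma longest_path_neighbor x y p z : longest_path x y p -> e x z -> z = y.
Proof.
move=> [xyp up pmax] xz; have [zp|zp] := boolP (z \in x :: y :: p).
  apply: (forest_path_neighbor xyp up); last by rewrite e_sym.
  by move: zp; rewrite inE => /orP[/eqP zx|//]; rewrite zx e_irr in xz.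
have zxyp : sorted e (z :: x :: y :: p) by rewrite [sorted _ _]/= e_sym xz.
have uzxyp : uniq (z :: x :: y :: p) by rewrite cons_uniq zp.
by have := pmax _ zxyp uzxyp; rewrite /= ltnn.
Qed.

Lemma longest_path_leaf x y p : longest_path x y p -> leaf e x.
Proof.
move=> lp; apply/cards1P; exists y; apply/setP => z; rewrite !inE.
apply/idP/eqP => [|->]; first exact: longest_path_neighbor lp.
by case: lp => /= /andP[].
Qed.

(** Substituting [z] for [x] gives another longest path. The list [take 1 p] holds the third vertex
    of the path, if there is one; acyclicity keeps [z] off the rest. *)
Lemma longest_path_leaves x y p z : longest_path x y p -> e y z ->
  ~~ (z \in take 1 p) -> leaf e z.
Proof.
move=> [xyp up pmax] yz zp; apply: (@longest_path_leaf z y p).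
move: xyp up => /= /andP[_ yp] /and3P[_ yp' up]; split.
- by rewrite /= e_sym yz.
- rewrite /= yp' up !andbT inE negb_or; apply/andP; split.
    by apply: contraL yz => /eqP->; rewrite e_irr.
  apply: contra zp => zp.
  have -> : z = head y p.
    apply: (forest_path_neighbor yp) => //; first by rewrite /= yp'.
    by rewrite e_sym.
  by case: p zp {yp yp' up pmax} => //= c q _; rewrite take0 mem_head.
- exact: pmax.
Qed.

Lemma leaf_neighbor a b z : leaf e a -> e a b -> e a z -> z = b.
Proof.
move=> /cards1P[c /setP ac] ab az.
by have := ac b; have := ac z; rewrite !inE ab az => /esym/eqP-> /esym/eqP->.
Qed.

Lemma forest_configuration a b : e a b ->
  (exists x y, isolated_edge e x y) \/ (exists s y c, distant_configuration e s y c).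
Proof.
case/exists_longest_path=> x [y [p lp]].
have xleaf := longest_path_leaf lp.
have xy : e x y by case: lp => /= /andP[].
have [yleaf|ynleaf] := boolP (leaf e y).
  by left; exists x, y; rewrite /isolated_edge xy xleaf yleaf.
(* The vertex [c] is the third one on the path; when the path has only two vertices, any neighbour
   of [y] other than [x] will do. *)
right; have [c [yc cx Hc]] :
    exists c, [/\ e y c, c != x & forall z, e y z -> z != c -> leaf e z].
  case: p lp => [|c p] lp.
    have [c cy cx] : exists2 c, c \in neighbors e y & c != x.
      apply/exists_inP; apply: contraR ynleaf => /exists_inPn H; apply/cards1P.
      exists x; apply/setP => z; apply/idP/set1P => [zy|->].
        by apply/eqP; rewrite -[_ == _]negbK; apply: H.
      by rewrite inE e_sym.
    exists c; rewrite inE in cy; split=> // z yz _.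
    exact: longest_path_leaves lp yz _.
  exists c; split.
  - by case: lp => /= /and3P[].
  - case: lp => _ /= /andP[+ _] _; rewrite !inE !negb_or => /and3P[_ xc _].
    by rewrite eq_sym.
  - move=> z yz zc; apply: longest_path_leaves lp yz _.
    by rewrite /= take0 mem_seq1.
exists (enum (neighbors e y :\ c)), y, c; split.
- by rewrite -cardE card_gt0; apply/set0Pn; exists x; rewrite !inE eq_sym cx e_sym.
- rewrite /= enum_uniq andbT inE !mem_enum !inE eqxx e_irr andbF /= orbF andbT.
  by apply: contraL yc => /eqP->; rewrite e_irr.
- apply/allP => z; rewrite mem_enum !inE => /andP[zc yz].
  have zleaf := Hc _ yz zc; rewrite /distant_leaf zleaf; apply/forallP => b'.
  apply/implyP => zb'; rewrite (@leaf_neighbor z y b') //; last by rewrite e_sym.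
  apply: leq_trans (subset_leq_card (_ : _ \subset [set c])) _; last by rewrite cards1.
  apply/subsetP => w; rewrite !inE => /andP[yw]; apply: contraR; exact: Hc.
- by move=> z; rewrite inE mem_enum !inE; case: eqP => [->|].
Qed.

End Forests.

(* In the symmetric difference of two distinct matchings with the same cover    *)
(* every vertex has degree 0 or 2, so that it is not a forest.                  *)
Lemma forest_matching_cover n (e : rel 'I_n) (M N : {set {set 'I_n}}) :
    ssrbool.symmetric e -> irreflexive e -> forest e ->
    is_matching e M -> is_matching e N -> cover M = cover N -> M = N.
Proof.
move=> e_sym e_irr fe mM mN MN.
pose X := (M :\: N) :|: (N :\: M); pose r : rel 'I_n := fun i j => [set i; j] \in X.
have XE E : E \in X -> E \in edges e.
  case/andP: mM mN => /subsetP Me _ /andP[/subsetP Ne _].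
  by rewrite !inE => /orP[]/andP[_] => [/Me|/Ne]; rewrite inE.
have re : subrel r e by move=> i j /XE; rewrite mem_edges.
have rsym : ssrbool.symmetric r by move=> i j; rewrite /r setUC.
have rirr : irreflexive r by move=> i; apply: contraFF (e_irr i) => /re.
suff X0 : X = set0.
  move/eqP: X0; rewrite setU_eq0 !setD_eq0 => /andP[MN' NM'].
  by apply/eqP; rewrite eqEsubset MN'.
apply/eqP; rewrite -[_ == _]negbK; apply/negP => /set0Pn[E EX].
have /edgesP[a [b [ab Eab]]] := XE _ EX; rewrite Eab in EX.
have [x [y [p lp]]] := exists_longest_path rirr EX.
have xy : [set x; y] \in X by case: lp => /= /andP[].
have xnbr z := longest_path_neighbor (z := z) rsym rirr (forest_sub re fe) lp.
(* If {x,y} were in [P] only, the edge of [Q] at [x] would be in [Q] only, hence be a second edge of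
   the symmetric difference at its end vertex [x]. *)
have xM P Q : is_matching e P -> is_matching e Q -> cover P = cover Q ->
    (forall z, [set x; z] \in Q :\: P -> z = y) -> [set x; y] \notin P :\: Q.
  move=> mP mQ PQ Hx; apply/negP; rewrite inE => /andP[xyQ xyP].
  have xQ : x \in cover Q by rewrite -PQ; apply: mem_cover xyP _; rewrite set21.
  have [z xz _] := matching_partner e_sym e_irr mQ xQ.
  have zy : z = y.
    apply: Hx; rewrite inE xz andbT; apply: contra xyQ => xzP.
    by rewrite (matching_partner_inj mP xyP xzP).
  by rewrite -zy xz in xyQ.
move: xy; rewrite inE; apply/negP; rewrite negb_or.
by rewrite !xM //= => z Hz; apply: xnbr; rewrite /r inE Hz ?orbT.
Qed.

(** * The monomial of a matching *)

Section MatchingMonomials.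
Variables (n : nat) (D : wograph n).
Implicit Types (a b i j : 'I_n) (A E : {set 'I_n}) (M N P : {set {set 'I_n}}).

Lemma adj_sym : ssrbool.symmetric (adj D).
Proof. by move=> i j; rewrite /adj orbC. Qed.

Lemma adj_irr : irreflexive (adj D).
Proof.
move=> i; rewrite /adj orbb; apply/negP => ii.
by have := arc_asym ii; rewrite ii.
Qed.

(* The exponent of x_i in the monomial of the edge {i, j}.                      *)
Definition edge_exp i j : nat := if Defs.arc D j i then wt D i else 1%N.

(** For an edge [E] containing [i] the sum has one term, given by the other endpoint; the sum avoids
    choosing an order of the endpoints. *)
Definition edge_mnm E : 'X_{1..n} :=
  [multinom (\sum_(j | E == [set i; j]) edge_exp i j)%N | i < n].

Definition matching_mnm M : 'X_{1..n} := (\sum_(E in M) edge_mnm E)%MM.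

Lemma edge_exp_gt0 i j : (0 < edge_exp i j)%N.
Proof. by rewrite /edge_exp; case: ifP => // _; apply: wt_gt0. Qed.

Lemma edge_mnmE i j : edge_mnm [set i; j] i = edge_exp i j.
Proof.
rewrite mnmE (eq_bigl (pred1 j)) ?big_pred1_eq // => k /=.
by apply/eqP/eqP => [/set2_inj|->].
Qed.

Lemma edge_mnm_out E i : i \notin E -> edge_mnm E i = 0%N.
Proof.
by move=> iE; rewrite mnmE big_pred0 // => j; apply: contraNF iE => /eqP->; rewrite set21.
Qed.

Lemma matching_mnmE M i j :
  is_matching (adj D) M -> [set i; j] \in M -> matching_mnm M i = edge_exp i j.
Proof.
move=> mM ijM; rewrite mnm_sumE (bigD1 _ ijM) /= edge_mnmE big1 ?addn0 //.
move=> E /andP[EM Eij]; apply: edge_mnm_out; apply: contraTN isT => iE.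
have Ee : E \in edges (adj D) by case/andP: mM => /subsetP/(_ _ EM).
have [k Ek _] := edge_partner adj_sym adj_irr Ee iE.
rewrite Ek in EM Eij.
by rewrite (matching_partner_inj mM EM ijM) eqxx in Eij.
Qed.

Lemma matching_mnm_out M i : i \notin cover M -> matching_mnm M i = 0%N.
Proof.
move=> iM; rewrite mnm_sumE big1 // => E EM; apply: edge_mnm_out.
by apply: contra iM; apply: mem_cover.
Qed.

Lemma matching_mnm_gt0 M i :
  is_matching (adj D) M -> (0 < matching_mnm M i)%N = (i \in cover M).
Proof.
move=> mM; apply/idP/idP => [|iM].
  by apply: contraTT => /matching_mnm_out->.
have [j ij _] := matching_partner adj_sym adj_irr mM iM.
by rewrite (matching_mnmE mM ij) edge_exp_gt0.
Qed.

Lemma matching_mnmU1 A M :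
  A \notin M -> matching_mnm (A |: M) = (edge_mnm A + matching_mnm M)%MM.
Proof. by move=> AM; rewrite /matching_mnm big_setU1. Qed.

Definition kmatching k M : bool := is_matching (adj D) M && (#|M| == k).

Definition matching_mnms k : seq 'X_{1..n} := [seq matching_mnm M | M in kmatching k].

Lemma matching_mnmsP k u :
  reflect (exists2 M, kmatching k M & u = matching_mnm M) (u \in matching_mnms k).
Proof. exact: imageP. Qed.

Lemma card_cover_matching M : is_matching (adj D) M -> #|cover M| = (#|M| * 2)%N.
Proof.
case/andP=> /subsetP Me /eqP <-.
rewrite (eq_bigr (fun=> 2%N)) ?sum_nat_const // => A /Me.
exact: (edges_card2 adj_irr).
Qed.

Hypothesis forest_D : forest (adj D).

Lemma kmatching_cover k M N :
  kmatching k M -> kmatching k N -> cover M \subset cover N -> M = N.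
Proof.
move=> /andP[mM /eqP Mk] /andP[mN /eqP Nk] MN.
apply: (forest_matching_cover adj_sym adj_irr forest_D mM mN).
by apply/eqP; rewrite eqEcard MN !card_cover_matching // Mk Nk leqnn.
Qed.

Lemma matching_mnm_antichain k M N : kmatching k M -> kmatching k N ->
  (matching_mnm M <= matching_mnm N)%MM -> M = N.
Proof.
move=> kM kN MN; apply: (kmatching_cover kM kN); apply/subsetP => i.
case/andP: kM kN => mM _ /andP[mN _].
rewrite -!matching_mnm_gt0 // => /leq_trans; apply; exact: (mnm_lepP MN).
Qed.

(* A larger exponent could be lowered without changing the support, against     *)
(* the unicity of perfect matchings in a forest.                                *)
Lemma matching_mnm_exchange k M N i j : kmatching k M -> kmatching k N -> i != j ->
    (matching_mnm N + U_(i) = matching_mnm M + U_(j))%MM ->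
  matching_mnm M i = 1%N /\ matching_mnm N i = 0%N.
Proof.
move=> kM kN ij NM.
have Nx x : (matching_mnm N x + (i == x) = matching_mnm M x + (j == x))%N.
  by move/mnmP/(_ x): NM; rewrite !mnmDE !mnm1E.
have Ni : (matching_mnm N i).+1 = matching_mnm M i.
  by have := Nx i; rewrite eqxx eq_sym (negbTE ij) addn1 addn0.
suff Ni0 : matching_mnm N i = 0%N by rewrite -Ni Ni0.
apply/eqP; rewrite -leqn0 leqNgt; apply/negP => Ni_gt0.
have mM : is_matching (adj D) M by case/andP: kM.
have mN : is_matching (adj D) N by case/andP: kN.
have MN : M = N.
  apply: (kmatching_cover kM kN); apply/subsetP => x.
  rewrite -!matching_mnm_gt0 //; have := Nx x; case: eqP => [<- //|_].
  by rewrite addn0 => -> Mx; rewrite addn_gt0 Mx.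
by move: Ni; rewrite MN; apply/eqP; rewrite gtn_eqF.
Qed.

End MatchingMonomials.

(** * Matching powers, and the role of constant exponents *)

Section MatchingPowers.
Variables (K : fieldType) (n : nat).
Local Notation S := {mpoly K[n]}.
Implicit Types (D : wograph n) (M N P : {set {set 'I_n}}).

Lemma edge_monomialE D a b :
  adj D a b -> edge_monomial K D a b = 'X_[edge_mnm D [set a; b]].
Proof.
have H i j : Defs.arc D i j ->
    'X_i * 'X_j ^+ wt D j = 'X_[edge_mnm D [set i; j]] :> S.
  move=> ij; have nij : i != j.
    by apply: contraTneq ij => ->; apply/negP => /[dup] /arc_asym/negP.
  rewrite mpolyXn -mpolyXD; congr 'X_[_]; apply/mnmP => x.
  rewrite mnmDE mulmnE !mnm1E; have [<-|xi] := eqVneq i x.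
    by rewrite edge_mnmE /edge_exp (negbTE (arc_asym ij)) eq_sym (negbTE nij) mul0n.
  have [<-|xj] := eqVneq j x.
    by rewrite setUC edge_mnmE /edge_exp ij mul1n.
  by rewrite edge_mnm_out // !inE negb_or eq_sym xi eq_sym.
move=> ab; rewrite /edge_monomial; case: ifP => [/H//|nab].
by rewrite setUC; apply: H; move: ab; rewrite /adj nab.
Qed.

Lemma wo_edge_idealP D :
  ideal_eq (wo_edge_ideal K D)
    (mono (fun u => exists2 E, E \in edges (adj D) & u = edge_mnm D E)).
Proof.
move=> f; split.
  apply: ideal_gen_min; first exact: mono_ideal.
  move=> _ [i [j [ij ->]]].
  have aij : adj D i j by rewrite /adj ij.
  have <- : edge_monomial K D i j = 'X_i * 'X_j ^+ wt D j by rewrite /edge_monomial ij.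
  rewrite edge_monomialE //; apply: mono_gen; exists [set i; j] => //.
  by rewrite (mem_edges (@adj_sym _ D)).
apply: mono_min; first exact: ideal_gen_ideal.
move=> _ [E /edgesP[i [j [ij ->]]] ->]; rewrite -edge_monomialE //.
apply: ideal_gen_in; rewrite /edge_monomial; case: ifP => [aij|naij].
  by exists i, j.
by exists j, i; move: ij; rewrite /adj naij.
Qed.

Lemma prod_mpolyX (T : finType) (u : T -> 'X_{1..n}) :
  \prod_i 'X_[u i] = 'X_[\sum_i u i] :> S.
Proof. by rewrite (big_morph (fun m => 'X_[m]) (@mpolyXD n K) (@mpolyX0 n K)). Qed.

(** Each of [k] monomials of the edge ideal with disjoint supports is divisible by an edge monomial,
    and disjointness of the supports makes these edges a matching. *)
Lemma wo_matching_powerP D k :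
  ideal_eq (wo_matching_power K D k) (mono (fun u => u \in matching_mnms D k)).
Proof.
move=> f; split.
  apply: ideal_gen_min; first exact: mono_ideal.
  move=> _ [u [uI u_disj ->]]; rewrite prod_mpolyX; apply/monoX.
  have /fin_all_exists[E HE] i :
      exists E, E \in edges (adj D) /\ (edge_mnm D E <= u i)%MM.
    by have /wo_edge_idealP/monoX[_ [E Ee ->] Eu] := uI i; exists E.
  have Esupp i : E i \subset msupport (u i).
    apply/subsetP => x xE; have [Ee Eu] := HE i.
    have [y Exy _] := edge_partner (@adj_sym _ D) (@adj_irr _ D) Ee xE.
    rewrite inE -lt0n; apply: leq_trans (mnm_lepP Eu x).
    by rewrite Exy edge_mnmE edge_exp_gt0.
  (* The sets [E i] are disjoint and nonempty, so [E] is injective and yields exactly [k] edges. *)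
  have [||tE injE] := @trivIimset _ _ predT E.
  - by move=> i j _ _ ji; apply: disjointWl (Esupp i) _; apply: disjointWr (Esupp j) _;
       apply: u_disj; rewrite eq_sym.
  - apply/imsetP => -[i _ Ei]; have [Ee _] := HE i.
    by have := edges_card2 (@adj_irr _ D) Ee; rewrite -Ei cards0.
  exists (matching_mnm D (E @: predT)).
    apply/matching_mnmsP; exists (E @: predT) => //; apply/andP; split; last first.
      by rewrite card_in_imset // card_ord.
    rewrite /is_matching tE andbT; apply/subsetP => _ /imsetP[i _ ->].
    by case: (HE i).
  apply/mnm_lepP => x; rewrite /matching_mnm big_imset //= !mnm_sumE.
  by apply: leq_sum => i _; have [_ /mnm_lepP] := HE i.
apply: mono_min; first exact: ideal_gen_ideal.
move=> _ /matching_mnmsP[M /andP[mM /eqP<-] ->]; apply: ideal_gen_in.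
exists (fun i => edge_mnm D (enum_val i)); split; last first.
- by rewrite prod_mpolyX /matching_mnm big_enum_val.
- move=> i j ij; case/andP: (mM) => _ /trivIsetP/(_ _ _ (enum_valP i) (enum_valP j)).
  rewrite (inj_eq enum_val_inj) ij => /(_ isT) Mij.
  have supp E : msupport (edge_mnm D E) \subset E.
    by apply/subsetP => x; rewrite inE; apply: contraNT => /edge_mnm_out->.
  by apply: disjointWl (supp _) _; apply: disjointWr (supp _) _.
- move=> i; apply/wo_edge_idealP/mono_gen; exists (enum_val i) => //.
  by case/andP: mM => /subsetP/(_ _ (enum_valP i)).
Qed.

Lemma min_gen_matching_power D k u : forest (adj D) ->
  min_gen (wo_matching_power K D k) u <-> u \in matching_mnms D k.
Proof.
move=> fD; apply: (min_genP (A := fun u => u \in _) _ (@wo_matching_powerP D k)) => v w.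
move=> /matching_mnmsP[M kM ->] /matching_mnmsP[N kN ->] MN.
by rewrite (matching_mnm_antichain fD kM kN MN).
Qed.

Definition constant_exponents D k : Prop :=
  forall M N i, kmatching D k M -> kmatching D k N -> i \in cover M ->
    matching_mnm D M i = if i \in cover N then matching_mnm D N i else 1%N.

(** Whenever the exponent of [i] is larger in [M] than in [N], the exchange at [i] lowers it, which
    [matching_mnm_exchange] permits only from 1 to 0. Hence two positive exponents cannot differ. *)
Lemma polymatroidal_constant_exponents D k : forest (adj D) ->
  polymatroidal (wo_matching_power K D k) -> constant_exponents D k.
Proof.
move=> fD [_ _ exch].
have exch1 M N i : kmatching D k M -> kmatching D k N ->
    (matching_mnm D N i < matching_mnm D M i)%N -> matching_mnm D M i = 1%N.
  move=> kM kN NMi.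
  have GM : min_gen (wo_matching_power K D k) (matching_mnm D M).
    by apply/min_gen_matching_power => //; apply/matching_mnmsP; exists M.
  have GN : min_gen (wo_matching_power K D k) (matching_mnm D N).
    by apply/min_gen_matching_power => //; apply/matching_mnmsP; exists N.
  have [j MNj] := exch _ _ GM GN _ NMi.
  rewrite min_gen_matching_power // => /matching_mnmsP[P kP MP].
  have ij : i != j by apply: contraTneq MNj => <-; rewrite -leqNgt ltnW.
  apply: (matching_mnm_exchange fD kM kP ij _).1; rewrite -MP.
  have iM : (U_(i) <= matching_mnm D M)%MM.
    by rewrite lep1mP -lt0n (leq_ltn_trans _ NMi).
  by rewrite -addmA [(U_(j) + _)%MM]addmC addmA submK.
move=> M N i kM kN iM.
have Mi : (0 < matching_mnm D M i)%N by rewrite matching_mnm_gt0 //; case/andP: kM.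
case: ifP => iN; last first.
  by apply: (exch1 M N) => //; rewrite (matching_mnm_out _ (negbT iN)).
have Ni : (0 < matching_mnm D N i)%N by rewrite matching_mnm_gt0 //; case/andP: kN.
apply/eqP; rewrite eqn_leq; apply/andP; split; rewrite leqNgt; apply/negP => lt_i.
  by move: (lt_i); rewrite (exch1 M N i kM kN lt_i) ltnS leqNgt Ni.
by move: (lt_i); rewrite (exch1 N M i kN kM lt_i) ltnS leqNgt Mi.
Qed.

Lemma constant_exponents_polymatroidal D k : forest (adj D) ->
    (forall M, is_matching (adj D) M -> (#|M| <= k)%N) ->
  constant_exponents D k -> polymatroidal (wo_matching_power K D k).
Proof.
move=> fD maxk expD; have ID := @wo_matching_powerP D k.
split.
- by apply/monomial_idealP; exists (fun u => u \in matching_mnms D k).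
- case E: (matching_mnms D k) => [|u0 s].
    by exists 0%N; apply: (generated_in_degree_mono ID) => u; rewrite E.
  have /matching_mnmsP[M kM u0E] : u0 \in matching_mnms D k by rewrite E mem_head.
  exists (mdeg u0); apply: (generated_in_degree_mono ID) => _ /matching_mnmsP[N kN ->].
  (* Both covers have [k * 2] elements. Adding the indicator of [cover M] to the exponents for [N],
     and that of [cover N] to the exponents for [M], gives an equality vertex by vertex: a vertex
     covered by just one of them has exponent 1 there. *)
  rewrite u0E !mdegE; apply/eqP; rewrite -(eqn_add2r (k * 2)); apply/eqP.
  case/andP: (kM) (kN) => mM /eqP Mk /andP[mN /eqP Nk].
  rewrite -{1}Mk -{1}Nk -(card_cover_matching mM) -(card_cover_matching mN) -!sum1_card.
  rewrite (big_mkcond (mem (cover M))) (big_mkcond (mem (cover N))) -!big_split.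
  apply: eq_bigr => i _ /=.
  have [iM|iM] := boolP (i \in cover M); have [iN|iN] := boolP (i \in cover N).
  + by rewrite (expD N M) // iM.
  + by rewrite (matching_mnm_out _ iN) (expD M N) // (negbTE iN).
  + by rewrite (matching_mnm_out _ iM) (expD N M) // (negbTE iM).
  + by rewrite !matching_mnm_out.
- move=> u v /(min_gen_matching_power _ _ fD)/matching_mnmsP[M kM ->].
  move=> /(min_gen_matching_power _ _ fD)/matching_mnmsP[N kN ->] i NMi.
  case/andP: (kM) (kN) => mM /eqP Mk /andP[mN /eqP Nk].
  have iM : i \in cover M by rewrite -(matching_mnm_gt0 _ mM) (leq_ltn_trans _ NMi).
  have iN : i \notin cover N.
    by apply: contraTN NMi => iN; rewrite (expD M N) // iN ltnn.
  have [j [P [jN jM mP Pk PM]]] := matching_exchange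
    (edges_card2 (@adj_irr _ D)) maxk mM mN Mk Nk iM iN.
  have kP : kmatching D k P by rewrite /kmatching Pk eqxx andbT.
  exists j; first by rewrite matching_mnm_out // matching_mnm_gt0.
  apply/min_gen_matching_power => //; apply/matching_mnmsP; exists P => //.
  have ij : i != j by apply: contraTneq jN => <-.
  (* Constancy reduces the equality to the covers: [i] has exponent 1 in [M] and [j] in [P], because
     [N] misses [i] and [M] misses [j]; every other vertex of [cover M] keeps its exponent. *)
  apply/mnmP => x; rewrite mnmDE mnmBE !mnm1E.
  have [<-|xj] := eqVneq j x.
    rewrite (matching_mnm_out _ jM) sub0n (expD P M) // ?PM ?setU11 //.
    by rewrite (negbTE jM).
  have [<-|xi] := eqVneq i x.
    rewrite (expD M N) // (negbTE iN) subnn matching_mnm_out // PM !inE eqxx orbF.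
    exact: ij.
  rewrite subn0 addn0.
  have [xM|xM] := boolP (x \in cover M); last first.
    rewrite !matching_mnm_out // PM !inE negb_or eq_sym xj /= negb_and xM.
    exact: orbT.
  by rewrite (expD M P) // PM !inE [x == i]eq_sym xi xM orbT.
Qed.

(** A linear step changes an exponent only between 0 and 1. So the class of generators with exponent
    at most 1 at [i], and the class with a given exponent larger than 1 at [i], are both closed
    under such steps. *)
Lemma linearly_related_constant_exponents D k : forest (adj D) ->
  linearly_related (wo_matching_power K D k) -> constant_exponents D k.
Proof.
move=> fD linD M N i kM kN iM.
have GM : min_gen (wo_matching_power K D k) (matching_mnm D M).
  by apply/min_gen_matching_power => //; apply/matching_mnmsP; exists M.
have GN : min_gen (wo_matching_power K D k) (matching_mnm D N).
  by apply/min_gen_matching_power => //; apply/matching_mnmsP; exists N.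
have Mi : (0 < matching_mnm D M i)%N by rewrite matching_mnm_gt0 //; case/andP: kM.
have step (g h : 'X_{1..n}) s t : g \in matching_mnms D k -> h \in matching_mnms D k ->
    (g + U_(s) = h + U_(t))%MM -> g i = h i \/ ((g i <= 1) && (h i <= 1))%N.
  case/matching_mnmsP=> [P kP ->] /matching_mnmsP[Q kQ ->] PQ.
  have [st|st] := eqVneq s t; first by move: PQ; rewrite st => /addIm->; left.
  have [Qs Ps] := matching_mnm_exchange fD kQ kP st PQ.
  have [Pt Qt] : matching_mnm D P t = 1%N /\ matching_mnm D Q t = 0%N.
    by apply: (matching_mnm_exchange fD kP kQ _ (esym PQ)); rewrite eq_sym.
  have [->|si] := eqVneq i s; first by right; rewrite Qs Ps.
  have [->|ti] := eqVneq i t; first by right; rewrite Qt Pt.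
  left; move/mnmP/(_ i): PQ.
  by rewrite !mnmDE !mnm1E ![_ == i]eq_sym (negbTE si) (negbTE ti) !addn0.
have conn (C : pred 'X_{1..n}) :
    (forall g h s t, g \in matching_mnms D k -> h \in matching_mnms D k ->
       (g + U_(s) = h + U_(t))%MM -> C g -> C h) ->
    C (matching_mnm D M) -> C (matching_mnm D N).
  by move=> HC; apply: linearly_related_connected (wo_matching_powerP D k) linD HC GM GN.
have N_gt0 : (0 < matching_mnm D N i)%N = (i \in cover N).
  by rewrite matching_mnm_gt0 //; case/andP: kN.
have [Mi1|Mi1] := leqP (matching_mnm D M i) 1.
  have Ni1 : (matching_mnm D N i <= 1)%N.
    apply: (conn (fun u => u i <= 1)%N) => // g h s t gA hA.
    by case/(step _ _ _ _ gA hA)=> [<-|/andP[]].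
  have -> : matching_mnm D M i = 1%N by apply/eqP; rewrite eqn_leq Mi1.
  by case: ifP => // iN; apply/esym/eqP; rewrite eqn_leq Ni1 N_gt0.
have /eqP Ni : matching_mnm D N i == matching_mnm D M i.
  apply: (conn (fun u => u i == matching_mnm D M i)) => // g h s t gA hA.
  case/(step _ _ _ _ gA hA)=> [<- //|].
  by move=> /andP[gi _] /eqP gM; rewrite gM leqNgt Mi1 in gi.
by rewrite -N_gt0 Ni Mi.
Qed.

End MatchingPowers.

(** * Transfer of constant exponents between [D] and its deletions *)

Section Deletion.
Variables (n : nat) (D : wograph n).
Implicit Types (a b i j x : 'I_n) (A E W : {set 'I_n}) (M N P : {set {set 'I_n}}).

Lemma adj_delete W i j :
  adj (delete D W) i j = [&& i \notin W, j \notin W & adj D i j].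
Proof.
by rewrite /adj /= /del_arc; case: (i \in W); case: (j \in W).
Qed.

Lemma forest_delete W : forest (adj D) -> forest (adj (delete D W)).
Proof. by apply: forest_sub => i j; rewrite adj_delete => /and3P[]. Qed.

Lemma edges_delete W E :
  (E \in edges (adj (delete D W))) = (E \in edges (adj D)) && [disjoint E & W].
Proof.
apply/edgesP/andP => [[i [j [+ ->]]]|[/edgesP[i [j [ij ->]]]]].
  by rewrite adj_delete disjoint2 mem_edges; [case/and3P=> -> -> -> | apply: adj_sym].
by rewrite disjoint2 => /andP[iW jW]; exists i, j; rewrite adj_delete iW jW.
Qed.

Lemma is_matching_delete W M :
  is_matching (adj (delete D W)) M = is_matching (adj D) M && [disjoint cover M & W].
Proof.
rewrite /is_matching -andbA [trivIset M && _]andbC andbA; congr (_ && _).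
apply/subsetP/andP => [MW|[/subsetP Me MW] E EM].
  split; first by apply/subsetP => E /MW; rewrite edges_delete => /andP[].
  rewrite disjoint_sym; apply/bigcup_disjointP => E /MW.
  by rewrite edges_delete disjoint_sym => /andP[].
rewrite edges_delete Me //= disjoint_sym; apply: disjoint_cover EM.
by rewrite disjoint_sym.
Qed.

Lemma kmatching_delete W k M :
  kmatching (delete D W) k M = kmatching D k M && [disjoint cover M & W].
Proof. by rewrite /kmatching is_matching_delete andbAC. Qed.

Lemma matching_mnm_delete W k M :
  kmatching (delete D W) k M -> matching_mnm (delete D W) M = matching_mnm D M.
Proof.
move=> kM; apply/mnmP => i; have [iM|iM] := boolP (i \in cover M); last first.
  by rewrite !matching_mnm_out.
case/andP: (kM) => mW _; have [j ij] := matching_partner (@adj_sym _ _) (@adj_irr _ _) mW iM.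
rewrite adj_delete => /and3P[iW jW _]; rewrite (matching_mnmE mW ij).
have mM : is_matching (adj D) M by move: mW; rewrite is_matching_delete => /andP[].
by rewrite (matching_mnmE mM ij) /edge_exp /= /del_arc iW jW.
Qed.

Lemma constant_exponents_delete W k :
  constant_exponents (delete D W) k <->
  forall M N i, kmatching D k M -> kmatching D k N ->
    [disjoint cover M & W] -> [disjoint cover N & W] -> i \in cover M ->
    matching_mnm D M i = if i \in cover N then matching_mnm D N i else 1%N.
Proof.
split=> H M N i.
  move=> kM kN MW NW; have [kM' kN'] : kmatching (delete D W) k M /\ kmatching (delete D W) k N.
    by rewrite !kmatching_delete kM MW kN NW.
  by rewrite -(matching_mnm_delete kM') -(matching_mnm_delete kN'); apply: H.
move=> /[dup] kM /matching_mnm_delete-> /[dup] kN /matching_mnm_delete->.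
by move: kM kN; rewrite !kmatching_delete => /andP[? ?] /andP[? ?]; apply: H.
Qed.

Lemma edge_mnm2 a b : a != b ->
  edge_mnm D [set a; b] = (U_(a) *+ edge_exp D a b + U_(b) *+ edge_exp D b a)%MM.
Proof.
move=> ab; apply/mnmP => x; rewrite mnmDE !mulmnE !mnm1E.
have [<-|xa] := eqVneq a x; first by rewrite edge_mnmE eq_sym (negbTE ab) mul1n mul0n addn0.
have [<-|xb] := eqVneq b x; first by rewrite setUC edge_mnmE mul1n.
by rewrite edge_mnm_out // !inE negb_or eq_sym xa eq_sym.
Qed.

Lemma kmatchingU1 k M a b : kmatching D k M -> adj D a b ->
    [disjoint cover M & [set a; b]] ->
  [/\ kmatching D k.+1 ([set a; b] |: M),
      cover ([set a; b] |: M) = [set a; b] :|: cover M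
    & matching_mnm D ([set a; b] |: M) = (edge_mnm D [set a; b] + matching_mnm D M)%MM].
Proof.
move=> /andP[mM /eqP Mk] ab; rewrite disjoint_sym => abM.
have Eab : [set a; b] \in edges (adj D) by rewrite mem_edges //; apply: adj_sym.
have [mP Pk] := matching_inU1 (edges_card2 (@adj_irr _ D)) mM Eab abM.
split; first by rewrite /kmatching Pk Mk eqxx andbT.
  exact: coverU1.
apply: matching_mnmU1; apply/negP => abM'.
by move: abM; rewrite disjoint2 (mem_cover abM') // set21.
Qed.

Lemma kmatchingD1 k M a b : kmatching D k.+1 M -> [set a; b] \in M ->
  [/\ kmatching D k (M :\ [set a; b]), [disjoint cover (M :\ [set a; b]) & [set a; b]]
    & cover M = [set a; b] :|: cover (M :\ [set a; b])].
Proof.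
move=> /andP[mM /eqP Mk] abM; have [mP Pk Pc] := matching_inD1 mM abM.
split.
- by rewrite /kmatching -eqSS -Pk Mk eqxx andbT.
- by rewrite Pc disjoint_sym disjoints_subset setCD subsetUr.
- rewrite Pc; apply/setP => x; rewrite !inE.
  have [xab|] := boolP ((x == a) || (x == b)); last by [].
  by rewrite (mem_cover abM) // !inE.
Qed.

Lemma matching_mnmD1 k M a b i : kmatching D k.+1 M -> [set a; b] \in M ->
  i \notin [set a; b] -> matching_mnm D M i = matching_mnm D (M :\ [set a; b]) i.
Proof.
move=> kM abM iab; rewrite -{1}(setD1K abM) matching_mnmU1 ?setD11 //.
by rewrite mnmDE edge_mnm_out.
Qed.

Lemma matching_mnmU1E k M a b i : kmatching D k M -> adj D a b ->
    [disjoint cover M & [set a; b]] -> i \in cover M ->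
  matching_mnm D ([set a; b] |: M) i = matching_mnm D M i.
Proof.
move=> kM ab abM iM; have [_ _ ->] := kmatchingU1 kM ab abM.
by rewrite mnmDE edge_mnm_out // (disjointFr abM iM).
Qed.

(** Adding {a,b} to two matchings that avoid it leaves all exponents outside {a,b} unchanged. *)
Lemma constant_exponents_link a b k : adj D a b -> constant_exponents D k.+1 ->
  constant_exponents (delete D [set a; b]) k.
Proof.
move=> ab expD; apply/constant_exponents_delete => M N i kM kN abM abN iM.
have [kM' cM _] := kmatchingU1 kM ab abM; have [kN' cN _] := kmatchingU1 kN ab abN.
rewrite -(matching_mnmU1E kM ab abM iM) (expD _ _ _ kM' kN') ?cM ?inE ?iM ?orbT //.
rewrite cN !inE; have iab := disjointFr abM iM; rewrite !inE in iab; rewrite iab /=.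
by case: ifP => // iN; rewrite (matching_mnmU1E kN ab abN iN).
Qed.

(** The vertices [a] and [b] are always matched to each other, which fixes their exponents; the
    others are compared after removal of {a,b}. *)
Lemma strong_constant_exponents a b k :
    (forall M, kmatching D k.+1 M -> [set a; b] \in M) ->
  constant_exponents (delete D [set a; b]) k -> constant_exponents D k.+1.
Proof.
move=> strong /constant_exponents_delete expD M N i kM kN iM.
have [abM abN] := (strong _ kM, strong _ kN).
have [iab|iab] := boolP (i \in [set a; b]).
  rewrite (mem_cover abN iab); case/andP: kM => mM _; case/andP: kN => mN _.
  have [j abj] : exists j, [set a; b] = [set i; j].
    by case/set2P: iab => ->; [exists b | exists a; rewrite setUC].
  by rewrite abj in abM abN; rewrite (matching_mnmE mM abM) (matching_mnmE mN abN).
have [kM' dM cM] := kmatchingD1 kM abM; have [kN' dN cN] := kmatchingD1 kN abN.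
rewrite (matching_mnmD1 kM abM iab) (matching_mnmD1 kN abN iab).
rewrite cM inE (negbTE iab) /= in iM.
by rewrite cN inE (negbTE iab); apply: expD.
Qed.

(** A vertex of weight 1 has exponent 1 in every matching covering it; this settles the partners of
    [b], even where one matching pairs them with another vertex. The vertex [b] has exponent [d],
    and all other vertices are compared after removing the edges at [b]. *)
Lemma star_constant_exponents b d k :
    (forall M, kmatching D k.+1 M -> b \in cover M) ->
    (forall M x, kmatching D k.+1 M -> [set b; x] \in M ->
      wt D x = 1%N /\ edge_exp D b x = d) ->
  constant_exponents (delete D [set b]) k -> constant_exponents D k.+1.
Proof.
move=> covb expb /constant_exponents_delete expD M N i kM kN iM.
case/andP: (kM) (kN) => mM _ /andP[mN _].
have wt1 P j : is_matching (adj D) P -> wt D j = 1%N -> j \in cover P -> matching_mnm D P j = 1%N.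
  move=> mP wj jP; have [l jl _] := matching_partner (@adj_sym _ _) (@adj_irr _ _) mP jP.
  by rewrite (matching_mnmE mP jl) /edge_exp wj if_same.
have [x bx _] := matching_partner (@adj_sym _ _) (@adj_irr _ _) mM (covb _ kM).
have [y by_ _] := matching_partner (@adj_sym _ _) (@adj_irr _ _) mN (covb _ kN).
have [[wx ex] [wy ey]] := (expb _ _ kM bx, expb _ _ kN by_).
have [->|ib] := eqVneq i b.
  by rewrite (covb _ kN) (matching_mnmE mM bx) (matching_mnmE mN by_) ex.
have [ix|ix] := eqVneq i x.
  rewrite -ix in wx; rewrite (wt1 _ _ mM wx iM).
  by case: ifP => // iN; rewrite (wt1 _ _ mN wx iN).
have [iy|iy] := eqVneq i y.
  rewrite -iy in wy; rewrite (wt1 _ _ mM wy iM).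
  by case: ifP => // iN; rewrite (wt1 _ _ mN wy iN).
have ibx : i \notin [set b; x] by rewrite !inE negb_or ib.
have iby : i \notin [set b; y] by rewrite !inE negb_or ib.
have [kM' dM cM] := kmatchingD1 kM bx; have [kN' dN cN] := kmatchingD1 kN by_.
rewrite (matching_mnmD1 kM bx ibx) (matching_mnmD1 kN by_ iby).
rewrite cM inE (negbTE ibx) /= in iM.
rewrite cN inE (negbTE iby) /=; apply: expD => //.
  by apply: disjointWr dM; rewrite sub1set set21.
by apply: disjointWr dN; rewrite sub1set set21.
Qed.

End Deletion.

(** * Factoring an edge out of a matching power *)

Section IdealEquations.
Variables (K : fieldType) (n : nat).
Local Notation S := {mpoly K[n]}.
Implicit Types (D : wograph n) (W : {set 'I_n}) (M N P : {set {set 'I_n}}).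
Implicit Types (I J : S -> Prop).

(** Allows an inclusion of a product [g * J] in [I] to be checked on generators of [J]. *)
Lemma colon_ideal I (g : S) : is_ideal I -> is_ideal (fun h => I (g * h)).
Proof.
case=> I0 ID IM; split; first by rewrite mulr0.
  by move=> f h If Ih; rewrite mulrDr; apply: ID.
by move=> f h Ih; rewrite mulrCA; apply: IM.
Qed.

Lemma wo_matching_power_ideal D k : is_ideal (wo_matching_power K D k).
Proof. exact: ideal_gen_ideal. Qed.

Lemma mem_wo_matching_power D W k M : kmatching D k M -> [disjoint cover M & W] ->
  wo_matching_power K (delete D W) k 'X_[matching_mnm D M].
Proof.
move=> kM MW; have kM' : kmatching (delete D W) k M by rewrite kmatching_delete kM.
apply/wo_matching_powerP/mono_gen; rewrite -(matching_mnm_delete kM').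
by apply/matching_mnmsP; exists M.
Qed.

Lemma wo_matching_power_min D W k I (f : S) : is_ideal I ->
    (forall M, kmatching D k M -> [disjoint cover M & W] -> I 'X_[matching_mnm D M]) ->
  wo_matching_power K (delete D W) k f -> I f.
Proof.
move=> idI HI /wo_matching_powerP; apply: mono_min => // _ /matching_mnmsP[M kM ->].
rewrite (matching_mnm_delete kM); rewrite kmatching_delete in kM.
by case/andP: kM; apply: HI.
Qed.

Lemma wo_matching_power_min0 D k I (f : S) : is_ideal I ->
    (forall M, kmatching D k M -> I 'X_[matching_mnm D M]) ->
  wo_matching_power K D k f -> I f.
Proof.
move=> idI HI /wo_matching_powerP; apply: mono_min => // _ /matching_mnmsP[M kM ->].
exact: HI.
Qed.

Lemma mem_wo_matching_power0 D k M : kmatching D k M ->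
  wo_matching_power K D k 'X_[matching_mnm D M].
Proof. by move=> kM; apply/wo_matching_powerP/mono_gen/matching_mnmsP; exists M. Qed.

Lemma wo_matching_power_eq0 D W k :
  ideal_eq (wo_matching_power K (delete D W) k) (zero_ideal K n) <->
  forall M, kmatching D k M -> ~~ [disjoint cover M & W].
Proof.
split=> [L0 M kM|noM f].
  apply/negP => MW; have /L0/(congr1 (mcoeff (matching_mnm D M)))/eqP :=
    mem_wo_matching_power kM MW.
  by rewrite mcoeffX eqxx mcoeff0 oner_eq0.
split=> [|->]; last by case: (wo_matching_power_ideal (delete D W) k).
apply: wo_matching_power_min => [|M kM MW]; last by move: (noM M kM); rewrite MW.
by split=> // [f1 g1 -> ->|f1 g1 ->]; rewrite /zero_ideal ?addr0 ?mulr0.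
Qed.

Lemma strong_ideal_eq D a b k : adj D a b ->
    (forall M, kmatching D k.+1 M -> [set a; b] \in M) ->
  ideal_eq (wo_matching_power K D k.+1)
    (ideal_scale (edge_monomial K D a b) (wo_matching_power K (delete D [set a; b]) k)).
Proof.
move=> ab strong f; rewrite edge_monomialE //; split.
  apply: (wo_matching_power_min0
    (ideal_scale_ideal _ (wo_matching_power_ideal _ _))) => M kM.
  have abM := strong _ kM; have [kM' dM _] := kmatchingD1 kM abM.
  exists 'X_[matching_mnm D (M :\ [set a; b])]; first exact: mem_wo_matching_power.
  by rewrite -mpolyXD -matching_mnmU1 ?setD11 // setD1K.
case=> h Jh ->; have idI := colon_ideal 'X_[edge_mnm D [set a; b]] (wo_matching_power_ideal D k.+1).
apply: (wo_matching_power_min idI) Jh => M kM dM.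
have [kP _ PE] := kmatchingU1 kM ab dM.
by rewrite -mpolyXD -PE; apply: mem_wo_matching_power0.
Qed.

Lemma var_ideal_mul_min I J (s : seq 'I_n) (h : S) : is_ideal I ->
    (forall i g, i \in s -> J g -> I ('X_i * g)) ->
  ideal_mul (var_ideal K s) J h -> I h.
Proof.
move=> idI H; apply: ideal_gen_min => // _ [g1 [g2 [g1s Jg2 ->]]].
rewrite mulrC; move: g1 g1s; apply: (ideal_gen_min (colon_ideal _ idI)).
by move=> _ [i si ->]; rewrite mulrC; apply: H.
Qed.

Lemma star_mem_power D b d x k M : adj D x b ->
    edge_exp D x b = 1%N -> edge_exp D b x = d ->
    kmatching D k M -> [disjoint cover M & [set x; b]] ->
  wo_matching_power K D k.+1 ('X_b ^+ d * ('X_x * 'X_[matching_mnm D M])).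
Proof.
move=> xb ex eb kM dM; have [kP _ PE] := kmatchingU1 kM xb dM.
have nxb : x != b by apply: contraTneq xb => ->; rewrite adj_irr.
rewrite mpolyXn -!mpolyXD addmA [X in (X + _)%MM]addmC.
have := edge_mnm2 D nxb; rewrite ex eb mulm1n => <-.
by rewrite -PE; apply: mem_wo_matching_power0.
Qed.

Lemma star_mnm_split D b d x k M : adj D x b ->
    edge_exp D x b = 1%N -> edge_exp D b x = d ->
    kmatching D k.+1 M -> [set b; x] \in M ->
  'X_[matching_mnm D M] = 'X_b ^+ d * ('X_x * 'X_[matching_mnm D (M :\ [set b; x])]) :> S.
Proof.
move=> xb ex eb kM bxM.
have nxb : x != b by apply: contraTneq xb => ->; rewrite adj_irr.
rewrite mpolyXn -!mpolyXD addmA [X in (X + _)%MM]addmC.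
have := edge_mnm2 D nxb; rewrite ex eb mulm1n => <-.
by rewrite [[set x; b]]setUC -matching_mnmU1 ?setD11 // setD1K.
Qed.

End IdealEquations.

(** * Maximum matchings around a distant configuration *)

Section DistantConfigurations.
Variables (K : fieldType) (n : nat) (D : wograph n) (k : nat).
Hypotheses (forest_D : forest (adj D)) (nuE : matching_number (adj D) = k.+1).
Local Notation S := {mpoly K[n]}.
Implicit Types (a b c x y : 'I_n) (s : seq 'I_n) (M N P : {set {set 'I_n}}).

Lemma matching_edge_adj M a b : is_matching (adj D) M -> [set a; b] \in M -> adj D a b.
Proof.
by case/andP=> /subsetP Me _ /Me; rewrite mem_edges //; apply: adj_sym.
Qed.

Lemma maximum_kmatching_meets M a b :
  kmatching D k.+1 M -> adj D a b -> ~~ [disjoint cover M & [set a; b]].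
Proof.
move=> kM ab; apply/negP => /(kmatchingU1 kM ab)[/andP[mP /eqP Pk] _ _].
by have := card_matching mP; rewrite Pk nuE ltnn.
Qed.

Lemma exists_maximum_kmatching : exists M, kmatching D k.+1 M.
Proof.
have m0 : is_matching (adj D) set0.
  by rewrite /is_matching sub0set; apply/trivIsetP => ? ?; rewrite inE.
have [|M mM ME] := eq_bigmax_cond (A := is_matching (adj D)) (fun M => #|M|).
  by apply/card_gt0P; exists set0.
by exists M; apply/andP; split => //; rewrite -ME -/(matching_number (adj D)) nuE.
Qed.

Lemma leaf_matching_edge M a b :
  is_matching (adj D) M -> leaf (adj D) a -> adj D a b -> a \in cover M -> [set a; b] \in M.
Proof.
move=> mM aleaf ab aM.
have [j aj jE] := matching_partner (@adj_sym _ _) (@adj_irr _ _) mM aM.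
by rewrite -(leaf_neighbor aleaf ab jE).
Qed.

Lemma leaf_neighbor_covered M a b :
  kmatching D k.+1 M -> leaf (adj D) a -> adj D a b -> b \in cover M.
Proof.
move=> kM aleaf ab; apply: contraR (maximum_kmatching_meets kM ab) => bM.
rewrite disjoint_sym disjoint2 bM andbT; apply: contra bM => aM.
case/andP: kM => mM _; have abM := leaf_matching_edge mM aleaf ab aM.
by apply: mem_cover abM _; rewrite set22.
Qed.

Lemma isolated_edge_strong M a b :
  isolated_edge (adj D) a b -> kmatching D k.+1 M -> [set a; b] \in M.
Proof.
case/and3P=> ab aleaf bleaf kM; have ba : adj D b a by rewrite adj_sym.
apply: leaf_matching_edge => //; first by case/andP: kM.
exact: leaf_neighbor_covered kM bleaf ba.
Qed.

Lemma edge_monomial_exp a b d : adj D a b ->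
  edge_monomial K D a b = 'X_a * 'X_b ^+ d -> edge_exp D b a = d.
Proof.
move=> ab; have nab : a != b by apply: contraTneq ab => ->; rewrite adj_irr.
rewrite edge_monomialE // mpolyXn -mpolyXD => /(congr1 (mcoeff (edge_mnm D [set a; b]))).
rewrite !mcoeffX eqxx; case: eqP => [/esym E _|_ /eqP]; last by rewrite oner_eq0.
by rewrite -[LHS](edge_mnmE) setUC E mnmDE mulmnE !mnm1E (negbTE nab) eqxx mul1n.
Qed.

Lemma edge_monomial_split a b d : adj D a b -> edge_exp D a b = 1%N ->
  edge_exp D b a = d -> edge_monomial K D a b = 'X_a * 'X_b ^+ d.
Proof.
move=> ab ea eb; have nab : a != b by apply: contraTneq ab => ->; rewrite adj_irr.
by rewrite edge_monomialE // edge_mnm2 // ea eb mulm1n mpolyXD mpolyXn.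
Qed.

Lemma strong_edge_constant_exponents a b :
    (forall M, kmatching D k.+1 M -> [set a; b] \in M) ->
    polymatroidal (wo_matching_power K (delete D [set a; b]) k) ->
  constant_exponents D k.+1.
Proof.
move=> strong /polymatroidal_constant_exponents expJ.
by apply: strong_constant_exponents strong (expJ _); apply: forest_delete.
Qed.

(** Adding {a,b} to the matchings avoiding [W] shows both that they have at most [k] edges and that
    they inherit constant exponents. It serves for [W] equal to {a,b}, {b} and {b,c}. *)
Lemma link_polymatroidal a b (W : {set 'I_n}) : constant_exponents D k.+1 -> adj D a b ->
    (forall M, is_matching (adj D) M -> [disjoint cover M & W] ->
       [disjoint cover M & [set a; b]]) ->
  polymatroidal (wo_matching_power K (delete D W) k).
Proof.
move=> expD ab abW; apply: constant_exponents_polymatroidal.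
- exact: forest_delete.
- move=> M; rewrite is_matching_delete => /andP[mM /(abW _ mM) dM].
  have kM : kmatching D #|M| M by rewrite /kmatching mM eqxx.
  have [/andP[mP /eqP Pk] _ _] := kmatchingU1 kM ab dM.
  by have := card_matching mP; rewrite nuE Pk.
have /constant_exponents_delete expJ := constant_exponents_link ab expD.
apply/constant_exponents_delete => M N i kM kN MW NW.
by apply: expJ => //; apply: abW => //; [case/andP: kM | case/andP: kN].
Qed.

Section Configuration.
Variables (s : seq 'I_n) (b c : 'I_n).
Hypothesis config : distant_configuration (adj D) s b c.

Lemma configuration_adj x : adj D b x = (x \in c :: s).
Proof. by case: config => _ _ _; apply. Qed.

Lemma configuration_leaf a : a \in s -> leaf (adj D) a /\ adj D a b.
Proof.
move=> sa; split; last by rewrite adj_sym configuration_adj inE sa orbT.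
by case: config => _ _ /allP/(_ _ sa)/andP[].
Qed.

Lemma configuration_head : exists a, a \in s.
Proof. by case: config => + _ _ _; case: (s) => // a ? _; exists a; apply: mem_head. Qed.

Lemma configuration_covered M : kmatching D k.+1 M -> b \in cover M.
Proof.
have [a /configuration_leaf[aleaf ab]] := configuration_head.
by move=> kM; apply: leaf_neighbor_covered kM aleaf ab.
Qed.

Lemma configuration_partner M : kmatching D k.+1 M ->
  exists x, [/\ x \in c :: s, adj D x b & [set b; x] \in M].
Proof.
move=> kM; case/andP: (kM) => mM _.
have [x bx abx] := matching_partner (@adj_sym _ _) (@adj_irr _ _) mM (configuration_covered kM).
by exists x; split; rewrite -?configuration_adj // adj_sym.
Qed.

Lemma configuration_link a M : a \in s -> is_matching (adj D) M ->
  [disjoint cover M & [set b]] -> [disjoint cover M & [set a; b]].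
Proof.
move=> /configuration_leaf[aleaf ab] mM; rewrite ![[disjoint cover M & _]]disjoint_sym.
rewrite disjoints1 disjoint2 => bM; rewrite bM andbT; apply: contra bM => aM.
by apply: (mem_cover (leaf_matching_edge mM aleaf ab aM)); rewrite set22.
Qed.

(** The edge at [b] of any maximum matching can be replaced by {a,b}, as [b] is the only neighbour
    of [a]. *)
Lemma configuration_extend a : a \in s ->
  exists M, kmatching D k.+1 M /\ [set a; b] \in M.
Proof.
move=> sa; have [M kM] := exists_maximum_kmatching.
have [x [_ _ bxM]] := configuration_partner kM.
have [kM' dM' _] := kmatchingD1 kM bxM.
have ab := (configuration_leaf sa).2.
have [|kP _ _] := kmatchingU1 kM' ab; last first.
  by exists ([set a; b] |: (M :\ [set b; x])); rewrite setU11.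
apply: configuration_link => //; first by case/andP: kM'.
by apply: disjointWr dM'; rewrite sub1set set21.
Qed.

(** Brings (d-3) under [star_constant_exponents]: [b] is always covered, its partners have weight 1,
    and its exponent is the same for all of them. *)
Lemma configuration_constant_exponents :
    (forall a, a \in s -> wt D a = 1%N) ->
    polymatroidal (wo_matching_power K (delete D [set b]) k) ->
    (ideal_eq (wo_matching_power K (delete D [set b; c]) k) (zero_ideal K n) ->
     exists d, forall a, a \in s -> edge_monomial K D a b = 'X_a * 'X_b ^+ d) ->
    (~ ideal_eq (wo_matching_power K (delete D [set b; c]) k) (zero_ideal K n) ->
     [/\ forall a, a \in s -> edge_monomial K D a b = 'X_a * 'X_b ^+ wt D b,
         wt D c = 1%N
       & exists J, ideal_eq (wo_matching_power K D k.+1) (ideal_scale ('X_b ^+ wt D b) J)]) ->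
  constant_exponents D k.+1.
Proof.
move=> wts polyJ caseL0 caseL.
have expJ := polymatroidal_constant_exponents (@forest_delete _ _ _ forest_D) polyJ.
pose avoid := [exists M, kmatching D k M && [disjoint cover M & [set b; c]]].
have [/existsP[N /andP[kN dN]]|] := boolP avoid.
  have [|em wc [J IJ]] := caseL.
    by move/wo_matching_power_eq0/(_ N kN); rewrite dN.
  apply: (star_constant_exponents (b := b) (d := wt D b)) => // [|M x kM bxM].
    exact: configuration_covered.
  case/andP: (kM) => mM _; have := matching_edge_adj mM bxM.
  rewrite configuration_adj inE => /orP[/eqP xc|xs]; last first.
    split; first exact: wts.
    exact: edge_monomial_exp (configuration_leaf xs).2 (em _ xs).
  rewrite xc in bxM *; split=> //.
  (* The equation makes ['X_b ^+ wt D b] divide the generator of [M], which determines the exponent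
     of [b] on the edge {b,c}. *)
  have /IJ[h _ Mh] := mem_wo_matching_power0 K kM.
  have : (U_(b) *+ wt D b <= matching_mnm D M)%MM.
    by apply: (@msupp_scaleX K n _ h); rewrite -mpolyXn -Mh msuppX mem_head.
  move=> /mnm_lepP/(_ b); rewrite mulmnE mnm1E eqxx mul1n (matching_mnmE mM bxM).
  rewrite /edge_exp; case: ifP => // _ wb.
  by apply/eqP; rewrite eqn_leq wb wt_gt0.
rewrite /avoid => /existsPn noL.
have [|d em] := caseL0.
  by apply/wo_matching_power_eq0 => M kM; have := noL M; rewrite kM.
apply: (star_constant_exponents (b := b) (d := d)) => // [|M x kM bxM].
  exact: configuration_covered.
case/andP: (kM) => mM _; have := matching_edge_adj mM bxM.
rewrite configuration_adj inE => /orP[/eqP xc|xs]; last first.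
  split; first exact: wts.
  exact: edge_monomial_exp (configuration_leaf xs).2 (em _ xs).
(* A maximum matching through {b,c} would leave a [k]-matching avoiding [b] and [c]. *)
rewrite xc in bxM; have [kM' dM' _] := kmatchingD1 kM bxM.
by have := noL (M :\ [set b; c]); rewrite kM' dM'.
Qed.

Section ConstantExponents.
Hypotheses (verts_D : verts D = [set: 'I_n])
           (source_D : forall i, source D i -> wt D i = 1%N)
           (exp_D : constant_exponents D k.+1).

Lemma no_arc_wt i : (forall j, ~~ Defs.arc D j i) -> wt D i = 1%N.
Proof. by move=> Hi; apply: source_D; split=> //; rewrite verts_D inE. Qed.

(** Since [M] misses [a], the exponent of [a] on {a,b} is 1. This exponent is the weight of [a] if
    the edge points to [a]; otherwise [a] is a source. *)
Lemma missed_leaf_wt a M : a \in s -> kmatching D k.+1 M -> a \notin cover M -> wt D a = 1%N.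
Proof.
move=> sa kM aM; have [aleaf ab] := configuration_leaf sa.
have [N [kN abN]] := configuration_extend sa.
have mN : is_matching (adj D) N by case/andP: kN.
have := exp_D kN kM (mem_cover abN (set21 _ _)).
rewrite (negbTE aM) (matching_mnmE mN abN) /edge_exp; case: ifP => // nba _.
apply: no_arc_wt => j; apply/negP => ja.
have aj : adj D a j by rewrite /adj ja orbT.
by rewrite (leaf_neighbor aleaf ab aj) nba in ja.
Qed.

(** A leaf [a] is missed by a maximum matching through another leaf of [s] or, if [s] has no other
    leaf, by one not containing the edge {a,b}, which is not strong. The default [b] of [head] is
    never reached, [s] being nonempty. *)
Lemma configuration_wt :
    ~ (s = [:: head b s] /\ strong_edge (adj D) (head b s) b) ->
  forall a, a \in s -> wt D a = 1%N.
Proof.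
move=> Hs a sa; have [aleaf ab] := configuration_leaf sa.
have [/hasP[a' sa' a'a]|/hasPn aall] := boolP (has (predC1 a) s).
  have [M [kM a'bM]] := configuration_extend sa'.
  have mM : is_matching (adj D) M by case/andP: kM.
  apply: (missed_leaf_wt sa kM); apply: contra a'a => aM /=.
  have abM := leaf_matching_edge mM aleaf ab aM.
  rewrite setUC in abM; rewrite setUC in a'bM.
  by rewrite (matching_partner_inj mM a'bM abM).
have s1 : s = [:: a].
  case: config => _ /and3P[_ _ us] _ _; apply: perm_small_eq => //.
  apply: uniq_perm => // x; rewrite mem_seq1; apply/idP/eqP => [/aall/negPn/eqP //|-> //].
have : ~~ strong_edge (adj D) a b by apply/negP => ss; apply: Hs; rewrite s1.
rewrite /strong_edge ab /= => /forallPn[M]; rewrite negb_imply nuE => /andP[kM abM].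
apply: (missed_leaf_wt sa kM); apply: contra abM => aM.
by apply: leaf_matching_edge aM => //; case/andP: kM.
Qed.

Hypothesis wt_s : forall a, a \in s -> wt D a = 1%N.

Lemma leaf_edge_exp a : a \in s -> edge_exp D a b = 1%N.
Proof. by move=> /wt_s wa; rewrite /edge_exp wa if_same. Qed.

Lemma configuration_exp M N x y : kmatching D k.+1 M -> kmatching D k.+1 N ->
  [set b; x] \in M -> [set b; y] \in N -> edge_exp D b x = edge_exp D b y.
Proof.
move=> kM kN bxM byN; have := exp_D kM kN (configuration_covered kM).
case/andP: kM => mM _; rewrite configuration_covered //; case/andP: kN => mN _.
by rewrite (matching_mnmE mM bxM) (matching_mnmE mN byN).
Qed.

Lemma leaves_edge_exp a a' : a \in s -> a' \in s -> edge_exp D b a = edge_exp D b a'.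
Proof.
move=> /configuration_extend[M [kM aM]] /configuration_extend[N [kN aN]].
by apply: (configuration_exp kM kN); rewrite setUC.
Qed.

(** The edge at [b] of a maximum matching is not {b,c}, so it splits off a variable from [s];
    conversely a matching avoiding [b] avoids all the leaves in [s]. *)
Lemma configuration_ideal0 d :
    (forall a, a \in s -> edge_exp D b a = d) ->
    (forall M, kmatching D k M -> ~~ [disjoint cover M & [set b; c]]) ->
  ideal_eq (wo_matching_power K D k.+1)
    (ideal_scale ('X_b ^+ d)
      (ideal_mul (var_ideal K s) (wo_matching_power K (delete D [set b]) k))).
Proof.
move=> exps noL f; split.
  apply: (wo_matching_power_min0 (ideal_scale_ideal _ (ideal_gen_ideal _))) => M kM.
  have [x [xcs xb bxM]] := configuration_partner kM.
  have [kM' dM' _] := kmatchingD1 kM bxM.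
  have xs : x \in s.
    move: xcs; rewrite inE => /orP[/eqP xc|//].
    by move: (noL _ kM'); rewrite -xc dM'.
  rewrite (star_mnm_split K xb (leaf_edge_exp xs) (exps _ xs) kM bxM); eexists; last by [].
  apply: ideal_gen_in; do 2 eexists; split; last by [].
    by apply: ideal_gen_in; exists x.
  by apply: mem_wo_matching_power => //; apply: disjointWr dM'; rewrite sub1set set21.
case=> h Jh ->.
have idI := colon_ideal ('X_b ^+ d) (wo_matching_power_ideal K D k.+1).
apply: (var_ideal_mul_min idI) Jh => x g xs Jg.
have idI' := colon_ideal 'X_x idI.
apply: (wo_matching_power_min idI') Jg => M kM dM.
apply: star_mem_power => //; first exact: (configuration_leaf xs).2.
- exact: leaf_edge_exp.
- exact: exps.
- by apply: configuration_link => //; case/andP: kM.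
Qed.

Lemma configuration_ideal d : edge_exp D c b = 1%N ->
    (forall x, x \in c :: s -> edge_exp D b x = d) ->
  ideal_eq (wo_matching_power K D k.+1)
    (ideal_scale ('X_b ^+ d)
      (ideal_add
        (ideal_mul (var_ideal K s) (wo_matching_power K (delete D [set b]) k))
        (ideal_scale 'X_c (wo_matching_power K (delete D [set b; c]) k)))).
Proof.
move=> expc exps f; split.
  apply: (wo_matching_power_min0 (ideal_scale_ideal _ (ideal_add_ideal
    (ideal_gen_ideal _) (ideal_scale_ideal _ (wo_matching_power_ideal _ _ _))))) => M kM.
  have [x [xcs xb bxM]] := configuration_partner kM.
  have [kM' dM' _] := kmatchingD1 kM bxM.
  have ex : edge_exp D x b = 1%N.
    by move: (xcs); rewrite inE => /orP[/eqP->|/leaf_edge_exp].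
  rewrite (star_mnm_split K xb ex (exps _ xcs) kM bxM); eexists; last by [].
  move: xcs; rewrite inE => /orP[/eqP xc|xs].
    exists 0; eexists; split; last by rewrite add0r.
      by case: (ideal_gen_ideal (fun f : S => exists g h,
        [/\ var_ideal K s g, wo_matching_power K (delete D [set b]) k h & f = g * h])).
    rewrite xc; eexists; last by [].
    by apply: mem_wo_matching_power; rewrite -?xc.
  eexists; exists 0; split; last by rewrite addr0.
    apply: ideal_gen_in; do 2 eexists; split; last by [].
      by apply: ideal_gen_in; exists x.
    by apply: mem_wo_matching_power => //; apply: disjointWr dM'; rewrite sub1set set21.
  by case: (ideal_scale_ideal 'X_c (wo_matching_power_ideal K (delete D [set b; c]) k)).
case=> _ [h1 [_ [Jh1 [h2 Lh2 ->] ->]] ->].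
have idI := colon_ideal ('X_b ^+ d) (wo_matching_power_ideal K D k.+1).
rewrite mulrDr; case: (wo_matching_power_ideal K D k.+1) => _ ID _; apply: ID.
  apply: (var_ideal_mul_min idI) Jh1 => x g xs Jg.
  have idI' := colon_ideal 'X_x idI.
  apply: (wo_matching_power_min idI') Jg => M kM dM.
  apply: star_mem_power => //; first exact: (configuration_leaf xs).2.
  - exact: leaf_edge_exp.
  - by apply: exps; rewrite inE xs orbT.
  - by apply: configuration_link => //; case/andP: kM.
have idI' := colon_ideal 'X_c idI.
apply: (wo_matching_power_min idI') Lh2 => M kM dM.
apply: star_mem_power => //; first by rewrite adj_sym configuration_adj mem_head.
  by apply: exps; rewrite mem_head.
by rewrite setUC.
Qed.

(** Both {b,c} and {a,b} extend [N] to a maximum matching. The second extension misses [c], so [c]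
    has exponent 1 in every maximum matching that covers it. The two kinds of extension also make
    every neighbour of [b] its partner in some maximum matching. *)
Lemma configuration_apex N : kmatching D k N -> [disjoint cover N & [set b; c]] ->
  wt D c = 1%N /\ forall x, x \in c :: s -> edge_exp D b x = wt D b.
Proof.
move=> kN dN; have mN : is_matching (adj D) N by case/andP: kN.
have bc : adj D b c by rewrite configuration_adj mem_head.
have [a sa] := configuration_head; have [aleaf ab] := configuration_leaf sa.
have [bN cN] : b \notin cover N /\ c \notin cover N.
  by apply/andP; rewrite -disjoint2 disjoint_sym.
have dNa : [disjoint cover N & [set a; b]].
  by apply: configuration_link => //; rewrite disjoint_sym disjoints1.
have [kNbc _ _] := kmatchingU1 kN bc dN; have [kNab covab _] := kmatchingU1 kN ab dNa.
have [ca cb] : c != a /\ c != b.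
  case: config => _ /and3P[]; rewrite !inE negb_or => /andP[bc' _] cs _ _ _.
  by split; [apply: contraNneq cs => -> | rewrite eq_sym].
have cNab : c \notin cover ([set a; b] |: N) by rewrite covab !inE !negb_or ca cb.
have c1 M x : kmatching D k.+1 M -> [set c; x] \in M -> edge_exp D c x = 1%N.
  move=> kM cxM; have := exp_D kM kNab (mem_cover cxM (set21 _ _)).
  by rewrite (negbTE cNab) (matching_mnmE _ cxM) //; case/andP: kM.
split.
  (* If an arc enters [c] from [d], the exponent of [c] on {c,d} is its weight; so it suffices to
     find a maximum matching through {c,d}. *)
  have [/existsP[d dc]|/existsPn Hc] := boolP [exists d, Defs.arc D d c]; last first.
    exact: no_arc_wt.
  have cd : adj D c d by rewrite /adj dc orbT.
  suff [M [kM /(c1 _ _ kM)]] : exists M, kmatching D k.+1 M /\ [set c; d] \in M.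
    by rewrite /edge_exp dc.
  have [<-|db] := eqVneq b d.
    by exists ([set b; c] |: N); split; rewrite // setUC setU11.
  have da : d != a.
    apply: contraNneq cb => da; rewrite da adj_sym in cd.
    by rewrite (leaf_neighbor aleaf ab cd).
  (* By maximality of {a,b} with [N], the vertex [d] is covered by [N]; exchanging its edge for
     {c,d} gives the required matching. *)
  have dN' : d \in cover N.
    apply: contraR (maximum_kmatching_meets kNab cd) => dN'.
    by rewrite disjoint_sym disjoint2 cNab covab !inE !negb_or da eq_sym db.
  have dab : d \notin [set a; b] by rewrite !inE negb_or da eq_sym.
  have [d' dd' _] := matching_partner (@adj_sym _ _) (@adj_irr _ _) mN dN'.
  have dd'ab : [set d; d'] \in [set a; b] |: N by rewrite inE dd' orbT.
  have [kP dP covP] := kmatchingD1 kNab dd'ab.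
  have [|kM _ _] := kmatchingU1 kP cd; last first.
    by exists ([set c; d] |: (([set a; b] |: N) :\ [set d; d'])); rewrite setU11.
  rewrite disjoint_sym disjoint2; apply/andP; split.
    by apply: contra cNab; rewrite covP inE => ->; rewrite orbT.
  by move: dP; rewrite disjoint_sym disjoint2 => /andP[].
have inmax x : x \in c :: s -> exists M, kmatching D k.+1 M /\ [set b; x] \in M.
  rewrite inE => /orP[/eqP->|/configuration_extend[M [kM]]].
    by exists ([set b; c] |: N); rewrite setU11.
  by rewrite setUC => xM; exists M.
have expx x y : x \in c :: s -> y \in c :: s -> edge_exp D b x = edge_exp D b y.
  move=> /inmax[M [kM xM]] /inmax[M' [kM' yM']].
  exact: configuration_exp kM kM' xM yM'.
(* The common exponent of [b] on its edges is its weight as soon as one of them points to [b]; if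
   none does, [b] is a source and both are 1. *)
have [/existsP[j jb]|/existsPn Hb] := boolP [exists j, Defs.arc D j b].
  have jcs : j \in c :: s by rewrite -configuration_adj /adj jb orbT.
  by move=> x xcs; rewrite (expx _ _ xcs jcs) /edge_exp jb.
by move=> x _; rewrite /edge_exp (negbTE (Hb x)) (no_arc_wt Hb).
Qed.

End ConstantExponents.
End Configuration.
End DistantConfigurations.

Theorem theorem3p2 (K : fieldType) (n : nat) (D : wograph n)
    (hV : verts D = [set: 'I_n])
    (hsource : forall i, source D i -> wt D i = 1%N)
    (hforest : forest (adj D))
    (hnu : (2 <= matching_number (adj D))%N)
    (hneq : ~ ideal_eq (wo_edge_ideal K D) (edge_ideal K (adj D))) :
  let nu := matching_number (adj D) in
  let I := wo_matching_power K D nu in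
  [<->
    (* (a) *)
    linearly_related I;
    (* (b) *)
    polymatroidal I;
    (* (c) *)
    linear_resolution I;
    (* (d) *)
    [\/ (* (d-1) *)
        exists a b : 'I_n,
        let J := wo_matching_power K (delete D [set a; b]) (nu - 1) in
        [/\ isolated_edge (adj D) a b,
            polymatroidal J
          & ideal_eq I (ideal_scale (edge_monomial K D a b) J)],
        (* (d-2) *)
        exists a b c : 'I_n,
        let J := wo_matching_power K (delete D [set a; b]) (nu - 1) in
        [/\ distant_configuration (adj D) [:: a] b c,
            strong_edge (adj D) a b,
            polymatroidal J
          & ideal_eq I (ideal_scale (edge_monomial K D a b) J)]
      | (* (d-3) *)
        exists (s : seq 'I_n) (b c : 'I_n),
        let J := wo_matching_power K (delete D [set b]) (nu - 1) in
        let L := wo_matching_power K (delete D [set b; c]) (nu - 1) in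
        [/\ distant_configuration (adj D) s b c,
            forall a, a \in s -> wt D a = 1%N,
            polymatroidal J,
            (* (d-3-i) *)
            ideal_eq L (zero_ideal K n) ->
            exists delta : nat,
            [/\ delta = 1%N \/ delta = wt D b,
                forall a, a \in s ->
                  edge_monomial K D a b = 'X_a * 'X_b ^+ delta
              & ideal_eq I (ideal_scale ('X_b ^+ delta)
                              (ideal_mul (var_ideal K s) J))]
          & (* (d-3-ii) *)
            ~ ideal_eq L (zero_ideal K n) ->
            [/\ polymatroidal L,
                forall a, a \in s ->
                  edge_monomial K D a b = 'X_a * 'X_b ^+ wt D b,
                wt D c = 1%N
              & ideal_eq I (ideal_scale ('X_b ^+ wt D b)
                  (ideal_add (ideal_mul (var_ideal K s) J)
                             (ideal_scale 'X_c L)))]]]].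
Proof.
move=> nu I.
have [k nuE] : exists k, matching_number (adj D) = k.+1.
  by exists (matching_number (adj D)).-1; rewrite prednK // ltnW.
have nu1 : (nu - 1)%N = k by rewrite /nu nuE subn1.
have IE : I = wo_matching_power K D k.+1 by rewrite /I /nu nuE.
rewrite {}nu1 {}IE {I nu}.
have maxk M : is_matching (adj D) M -> (#|M| <= k.+1)%N.
  by move=> /card_matching; rewrite nuE.
have expP : polymatroidal (wo_matching_power K D k.+1) -> constant_exponents D k.+1.
  exact: polymatroidal_constant_exponents.
have polyP : constant_exponents D k.+1 -> polymatroidal (wo_matching_power K D k.+1).
  exact: constant_exponents_polymatroidal.
have linP : polymatroidal (wo_matching_power K D k.+1) ->
    linear_resolution (wo_matching_power K D k.+1).
  exact/polymatroidal_linear_resolution/wo_matching_powerP.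
have relP : linear_resolution (wo_matching_power K D k.+1) ->
    linearly_related (wo_matching_power K D k.+1).
  case=> d [Id [F [FI Fb]]]; exists d; split=> //; exists F; split=> // j jd.
  by apply: Fb; rewrite addn1.
have expL : linearly_related (wo_matching_power K D k.+1) -> constant_exponents D k.+1.
  exact: linearly_related_constant_exponents.
tfae.
- by move=> /expL/polyP.
- exact: linP.
- move=> /relP/expL expD.
  have [M0 kM0] := exists_maximum_kmatching nuE.
  (* A longest path needs an edge to start from; any edge of a maximum matching serves. *)
  have [a0 [b0 ab0]] : exists a b, adj D a b.
    case/andP: kM0 => mM /eqP Mk; have /card_gt0P[E EM] : (0 < #|M0|)%N by rewrite Mk.
    case/andP: mM => /subsetP/(_ _ EM)/edgesP[a [b [ab _]]] _.
    by exists a, b.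
  have link a b W := @link_polymatroidal K n D k hforest nuE a b W expD.
  have [[a [b iab]]|[s [b [c config]]]] :=
    forest_configuration (@adj_sym _ D) (@adj_irr _ D) hforest ab0.
    have ab : adj D a b by case/and3P: iab.
    apply: Or31; exists a, b; split=> //; first exact: (link a b _).
    apply: strong_ideal_eq => // M; exact: isolated_edge_strong.
  have [a1 sa1] := configuration_head config.
  have [aleaf ab1] := configuration_leaf config sa1.
  (* A single leaf on a strong edge leads to (d-2); in all other cases the leaves of [s] have weight
     1, and (d-3) holds. *)
  have [/andP[/eqP s1 strong]|nstrong] :=
      boolP ((s == [:: head b s]) && strong_edge (adj D) (head b s) b).
    have ab : adj D (head b s) b by case/andP: strong.
    apply: Or32; exists (head b s), b, c; split=> //.
    - by rewrite -s1.
    - exact: (link (head b s) b _).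
    apply: strong_ideal_eq => // M /andP[mM /eqP Mk].
    by case/andP: strong => _ /forallP/(_ M); rewrite mM nuE Mk eqxx.
  have wt_s : forall a, a \in s -> wt D a = 1%N.
    apply: (configuration_wt nuE config hV hsource expD) => -[s1 strong].
    by move: nstrong; rewrite -s1 eqxx strong.
  have exp_a a : a \in s -> edge_exp D a b = 1%N by apply: leaf_edge_exp.
  have exp_b a : a \in s -> edge_exp D b a = edge_exp D b a1.
    by move=> sa; apply: (leaves_edge_exp nuE config expD).
  have adj_s a : a \in s -> adj D a b by case/(configuration_leaf config).
  apply: Or33; exists s, b, c; split=> //.
  - by apply: (link a1 b _) => // M; apply: configuration_link config _ _ sa1.
  - move=> /wo_matching_power_eq0 noL; exists (edge_exp D b a1); split.
    + by rewrite /edge_exp; case: ifP; auto.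
    + by move=> a sa; apply: edge_monomial_split; auto.
    + exact: (configuration_ideal0 nuE config wt_s).
  (* A nonzero matching power provides a [k]-matching avoiding [b] and [c], from which the weight of
     [c] and the exponents at [b] follow. *)
  move=> L0; have /existsP[N /andP[kN dN]] :
      [exists M, kmatching D k M && [disjoint cover M & [set b; c]]].
    apply: contra_notT L0 => /existsPn noL; apply/wo_matching_power_eq0 => M kM.
    by have := noL M; rewrite kM.
  have [wc exps] := configuration_apex nuE config hV hsource expD kN dN.
  split=> //.
  + by apply: (link b c _) => //; rewrite (configuration_adj config) mem_head.
  + move=> a sa; apply: edge_monomial_split; auto.
    by apply: exps; rewrite inE sa orbT.
  + apply: (configuration_ideal nuE config wt_s) => //.
    by rewrite /edge_exp wc if_same.
- move=> cond; apply/relP/linP/polyP; case: cond.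
  + case=> a [b [iab polyJ _]].
    apply: (strong_edge_constant_exponents hforest) polyJ => M.
    exact: isolated_edge_strong.
  + case=> a [b [c [_ strong polyJ _]]].
    apply: (strong_edge_constant_exponents hforest) polyJ => M /andP[mM /eqP Mk].
    by case/andP: strong => _ /forallP/(_ M); rewrite mM nuE Mk eqxx.
  + case=> s [b [c [config wt_s polyJ caseL0 caseL]]].
    apply: (configuration_constant_exponents hforest nuE config wt_s polyJ).
      by move=> /caseL0[d [_ em _]]; exists d.
    by move=> /caseL[_ em wc IJ]; split=> //; eexists; exact: IJ.
Qed.
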